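(* Let $\alpha\in(0,1/2)$ and let $f:[0,\infty)\to\mathbb{R}$ be strictly monotone with $f(0)=0$. There exists a constant $\epsilon>0$ such that for all sufficiently large $n$ and all $k\le\alpha n$, any randomized streaming algorithm which outputs (with constant probability) a $(1+\epsilon)$-approximation to $\sum_{i=1}^k f(\sigma_i(A))$ of an $n\times n$ matrix $A$ given as a stream of entry updates requires $\Omega(n^{1+\Theta(1/\ln\alpha)})$ bits of space. This holds even when $A$ is promised to have $O(n)$ non-zero entries.
   Context: Streaming model: an underlying $n\times n$ matrix $A$ (initially zero) receives a sequence of updates $(i,j,\delta)$ meaning $A_{i,j}\leftarrow A_{i,j}+\delta$; the algorithm outputs its estimate at the end. $\sigma_1(A)\ge\sigma_2(A)\ge\cdots\ge\sigma_n(A)$ are the singular values of $A$. A $(1+\epsilon)$-approximation to $Q$ is a value in $[(1-\epsilon)Q,(1+\epsilon)Q]$. The constants hidden in $\Omega$ and $\Theta$ may depend on $\alpha$. *)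

(* Defs.v *)
From HB Require Import structures.
From mathcomp Require Import all_boot all_order all_algebra.
From mathcomp Require Import polyrcf.
From mathcomp Require Import all_classical all_reals all_analysis.

Set Implicit Arguments.
Unset Strict Implicit.
Unset Printing Implicit Defensive.

Import Order.TTheory GRing.Theory Num.Theory.
Local Open Scope classical_set_scope.
Local Open Scope ring_scope.

(* The square roots of the eigenvalues of A^T A, listed with multiplicity in
   nonincreasing order.  [rootsR] lists each real root once; [mup] is the
   multiplicity of a root.  The i-th singular value of the usual (1-based)
   numbering is at index i.-1. *)
Definition singular_values (R : realType) (n : nat) (A : 'M[R]_n) : seq R :=
  let p := char_poly (A^T *m A) in
  sort >=%R (flatten [seq nseq (mup x p) (Num.sqrt x) | x <- rootsR p]).

Definition top_sum (R : realType) (n : nat) (f : R -> R) (k : nat)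
    (A : 'M[R]_n) : R :=
  \sum_(i < k) f (nth 0 (singular_values A) i).

(* [f] is only constrained on [0, +oo[. *)
Definition strictly_monotone_nonneg (R : realType) (f : R -> R) : Prop :=
  (forall x y, 0 <= x -> x < y -> f x < f y) \/
  (forall x y, 0 <= x -> x < y -> f y < f x).

(* For Q >= 0 this is x \in `[(1 - eps) * Q, (1 + eps) * Q].  For Q < 0, which
   happens when f is decreasing, it is the interval between the same two
   endpoints. *)
Definition approximates (R : realType) (eps Q x : R) : Prop :=
  `|x - Q| <= eps * `|Q|.

(* ((i, j), delta) stands for A_ij <- A_ij + delta. *)
Definition update (R : realType) (n : nat) : Type := ('I_n * 'I_n * R)%type.

Definition stream (R : realType) (n : nat) : Type := seq (update R n).

Definition stream_mx (R : realType) (n : nat) (s : stream R n) : 'M[R]_n :=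
  \sum_(u <- s) u.2 *: delta_mx u.1.1 u.1.2.

Definition nnz (R : realType) (n : nat) (A : 'M[R]_n) : nat :=
  #|[pred ij : 'I_n * 'I_n | A ij.1 ij.2 != 0]|.

(* Linearly many integer updates of magnitude at most K, producing a matrix
   with linearly many nonzero entries. *)
Definition sparse_stream (R : realType) (n K : nat) (s : stream R n) : Prop :=
  [/\ (forall u, u \in s -> u.2 \is a Num.int /\ `|u.2| <= K%:R),
      (size s <= K * n)%N &
      (nnz (stream_mx s) <= K * n)%N].

(* A one-pass algorithm with b bits of memory.  The random seed w : Om is
   read-only and not charged to the space; the step function also sees the
   position in the stream (uncharged), so that fresh coins, i.e. a new part of
   the seed, can be used at each update. *)
Record streaming_algorithm (R : realType) (n b : nat) (d : measure_display)
    (Om : measurableType d) := StreamingAlgorithm {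
  alg_init : Om -> b.-tuple bool ;
  alg_step : Om -> nat -> b.-tuple bool -> update R n -> b.-tuple bool ;
  alg_output : Om -> b.-tuple bool -> R ;
  measurable_alg_init : forall m, measurable [set w | alg_init w = m] ;
  measurable_alg_step : forall t m u m',
    measurable [set w | alg_step w t m u = m'] ;
  measurable_alg_output : forall m,
    measurable_fun setT (fun w => alg_output w m) }.

Section Run.
Context (R : realType) (n b : nat) (d : measure_display)
  (Om : measurableType d) (alg : streaming_algorithm R n b Om).

Fixpoint run_from (w : Om) (t : nat) (m : b.-tuple bool) (s : stream R n) :
    b.-tuple bool :=
  if s is u :: s' then run_from w t.+1 (alg_step alg w t m u) s' else m.

Definition run (w : Om) (s : stream R n) : R :=
  alg_output alg w (run_from w 0 (alg_init alg w) s).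

End Run.

(* For every stream in the input class D, with probability at least p the
   output is a (1 + eps)-approximation to f(sigma_1) + ... + f(sigma_k). *)
Definition approximates_top_sum (R : realType) (n b : nat)
    (d : measure_display) (Om : measurableType d) (P : probability Om R)
    (alg : streaming_algorithm R n b Om) (D : set (stream R n))
    (f : R -> R) (k : nat) (eps p : R) : Prop :=
  forall s, D s ->
    (p%:E <= P [set w | approximates eps (top_sum f k (stream_mx s))
                                     (run alg w s)])%E.

(* theta(alpha) = Theta(1 / ln alpha) on ]0, 1/2[.  Both sides are negative
   there, as ln alpha < 0. *)
Definition is_Theta_inv_ln (R : realType) (theta : R -> R) : Prop :=
  exists c1 c2 : R, [/\ 0 < c1, 0 < c2 &
    forall alpha, 0 < alpha < 2^-1 ->
      c2 / ln alpha <= theta alpha <= c1 / ln alpha].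

(* Main.v *)
(* The hard instance is a hidden hypermatching problem. Alice has x in
   {0,1}^N; Bob has m random hyperedges of t = 2h vertices each, with
   N = 4 m t^2, and bits w_a that are either all equal to the parity of x on
   the a-th hyperedge, or all equal to its negation.

   Reduction. For every hyperedge a and every u in {0,1}^t of parity w_a, Bob
   inserts a row of ones on t columns, and Alice puts x_j + u_j on the diagonal
   entries of these columns, so the block contributes J_t + diag (x + u) to
   A^T A. Its largest eigenvalue is t + 1 if x + u is all ones, which happens
   for exactly one u if w_a is the parity and never if it is the negation, and
   then it is at most t + 1 - 1 / (t + 1). A hyperedge meeting another one is
   discarded by Bob; with probability at least 1/2 at most half of them are.

   Communication. For a message class A in {0,1}^N, the squared l2 advantage
   of Bob, averaged over the hyperedges, is the sum over x, y in A of
   (1 + rho^t)^m - 1, where rho is the normalised sum of (-1)^(x_v + y_v).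
   Typically rho^2 is about b / N when A has density 2^-b, so this is small as
   long as m (b / N)^(t / 2) is, that is for b << N^(1 - 2 / t); the tail is
   controlled by the moment of exp (N rho^2 / 16) on the cube. *)
Require Import Defs.
From HB Require Import structures.
From mathcomp Require Import all_boot all_order all_algebra.
From mathcomp Require Import polyrcf.
From mathcomp Require Import all_classical all_reals all_analysis.
From mathcomp Require Import measurable_realfun ring lra zify.

Set Implicit Arguments.
Unset Strict Implicit.
Unset Printing Implicit Defensive.

Import Order.TTheory GRing.Theory Num.Theory.
Local Open Scope ring_scope.

(** * Singular values *)

Lemma char_poly_conjmx (F : fieldType) n (P S : 'M[F]_n) :
  P \in unitmx -> char_poly (P *m S *m invmx P) = char_poly S.
Proof.
move=> Pu; rewrite /char_poly.
have -> : char_poly_mx (P *m S *m invmx P) =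
    map_mx polyC P *m char_poly_mx S *m map_mx polyC (invmx P).
  rewrite /char_poly_mx mulmxBr mulmxBl !map_mxM /=; congr (_ - _).
  by rewrite scalar_mxC -mulmxA -map_mxM mulmxV// map_mx1 mulmx1.
rewrite !det_mulmx mulrAC -det_mulmx -map_mxM mulmxV//.
by rewrite map_mx1 det1 mul1r.
Qed.

Lemma mup_char_poly_ge (F : fieldType) n k (S : 'M[F]_n) (U : 'M[F]_(k, n)) a :
  row_free U -> U *m S = a *: U -> (k <= mup a (char_poly S))%N.
Proof.
move=> Uf US; set P := row_ebase U.
have Pu : P \in unitmx by exact: row_ebase_unit.
have rU : \rank U = k by apply/eqP.
have kn : (k <= n)%N by rewrite -rU rank_leq_col.
set T := P *m S *m invmx P.
have pT : (pid_mx k : 'M[F]_(k, n)) *m T = a *: pid_mx k.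
  have UE := mulmx_ebase U; rewrite rU -/P in UE.
  have -> : (pid_mx k : 'M[F]_(k, n)) = invmx (col_ebase U) *m U *m invmx P.
    by rewrite -{2}UE !mulmxA mulVmx ?col_ebase_unit// mul1mx mulmxK.
  by rewrite /T !mulmxA mulmxKV// -(mulmxA _ U S) US scalemxAl scalemxAr.
have cT : char_poly S = char_poly T by rewrite (char_poly_conjmx S Pu).
clearbody T.
have Tij (i j : 'I_n) : (i < k)%N -> T i j = a *+ (i == j).
  move=> ik; have /matrixP/(_ (Ordinal ik) j) := pT.
  rewrite !mxE (bigD1 i)//= big1 => [|l li]; rewrite !mxE/=; last first.
    by rewrite eq_sym -val_eqE in li; rewrite (negbTE li) mul0r.
  by rewrite eqxx ik mul1r addr0 andbT mulr_natr.
rewrite mup_geq; last by rewrite monic_neq0// char_poly_monic.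
rewrite cT /char_poly.
pose d : 'rV[{poly F}]_n := \row_i (if (i < k)%N then 'X - a%:P else 1).
pose B : 'M[{poly F}]_n :=
  \matrix_(i, j) (if (i < k)%N then (i == j)%:R else char_poly_mx T i j).
have -> : char_poly_mx T = diag_mx d *m B.
  rewrite mul_diag_mx; apply/matrixP => i j; rewrite !mxE.
  case: ifP => ik; last by rewrite mul1r.
  by rewrite Tij//; case: eqP; rewrite ?mulr1n ?mulr0n ?mulr1 ?mulr0 ?subr0.
rewrite det_mulmx det_diag dvdp_mulr//.
have -> : \prod_i d 0 i = ('X - a%:P) ^+ k.
  under eq_bigr do rewrite mxE.
  rewrite -big_mkcond/= big_const_seq.
  have -> : count (fun i : 'I_n => (i < k)%N) (index_enum 'I_n) = k.
    rewrite -sum1_count -(big_ord_widen n (fun=> 1%N) kn) sum1_card.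
    by rewrite card_ord.
  by rewrite -Monoid.iteropE.
exact: dvdpp.
Qed.

Section SingularValues.
Context (R : realType) (n : nat).
Implicit Types A : 'M[R]_n.

Lemma mem_singular_values_le A lam :
  (forall u : 'rV[R]_n,
    \sum_i (u *m A^T) 0 i ^+ 2 <= lam * \sum_i u 0 i ^+ 2) ->
  forall s, s \in singular_values A -> 0 <= s <= Num.sqrt lam.
Proof.
move=> hA s; rewrite mem_sort => /flatten_mapP[x xr].
rewrite mem_nseq => /andP[_ /eqP->]; rewrite sqrtr_ge0/=.
have p0 : char_poly (A^T *m A) != 0 by rewrite monic_neq0// char_poly_monic.
have := roots_on_rootsR p0 x; rewrite xr inE/= => rx.
apply: ler_wsqrtr.
have : eigenvalue (A^T *m A) x by rewrite eigenvalue_root_char.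
case/eigenvalueP => u ux u0.
have sq (v : 'rV[R]_n) : (v *m v^T) 0 0 = \sum_i v 0 i ^+ 2.
  by rewrite mxE; apply: eq_bigr => i _; rewrite mxE expr2.
have upos : 0 < \sum_i u 0 i ^+ 2.
  rewrite lt_def sumr_ge0 ?andbT => [|i _]; last exact: sqr_ge0.
  apply/negP => /eqP s0; case/negP: u0; apply/eqP/rowP => i; rewrite mxE.
  apply/eqP; rewrite -sqrf_eq0; apply/eqP.
  by move: i (erefl true); apply: psumr_eq0P s0 => i _; exact: sqr_ge0.
rewrite -(ler_pM2r upos); apply: le_trans (hA u).
by rewrite -sq -(sq (u *m A^T)) trmx_mul trmxK mulmxA -(mulmxA u) ux -scalemxAl [leRHS]mxE.
Qed.

Lemma count_singular_values_ge A k (U : 'M[R]_(k, n)) lam :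
  (0 < k)%N -> row_free U -> U *m (A^T *m A) = lam *: U ->
  (k <= count_mem (Num.sqrt lam) (singular_values A))%N.
Proof.
move=> k0 Uf US; have km := mup_char_poly_ge Uf US.
rewrite /singular_values (permP (permEl (perm_sort _ _))).
set p := char_poly _ in km *.
have p0 : p != 0 by rewrite monic_neq0// char_poly_monic.
have lr : lam \in rootsR p.
  rewrite -(roots_on_rootsR p0 lam) inE/= -dvdp_XsubCl XsubC_dvd//.
  exact: leq_trans km.
rewrite count_flatten -map_comp.
apply: leq_trans km _; move: lr.
elim: (rootsR p) => //= x r IH; rewrite inE => /predU1P[<-|/IH].
  by rewrite count_nseq/= eqxx mul1n leq_addr.
by move=> /leq_trans; apply; rewrite leq_addl.
Qed.

Lemma singular_values_sorted A : sorted >=%R (singular_values A).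
Proof. by apply: sort_sorted => x y; exact: le_total. Qed.

Lemma top_sum_eq_max A (f : R -> R) k s :
  (forall x, x \in singular_values A -> x <= s) ->
  (k <= count_mem s (singular_values A))%N ->
  top_sum f k A = k%:R * f s.
Proof.
rewrite /top_sum; have := singular_values_sorted A.
elim: (singular_values A) k => [|x r IH] k /= sr hs.
  by rewrite leqn0 => /eqP->; rewrite big_ord0 mul0r.
case: k => [|k] hk; first by rewrite big_ord0 mul0r.
have rs : sorted >=%R r by exact: path_sorted sr.
have xs : x = s.
  apply/eqP/negPn/negP => xs; rewrite (negbTE xs) add0n in hk.
  have : s \in r by rewrite -has_pred1 has_count (leq_trans _ hk).
  move=> sr'; have /allP/(_ _ sr')/= := order_path_min ge_trans sr.
  by rewrite leNgt lt_neqAle xs hs ?mem_head.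
rewrite big_ord_recl/= IH//.
- by rewrite xs -natr1 mulrDl mul1r addrC.
- by move=> y yr; apply: hs; rewrite inE yr orbT.
- by move: hk; rewrite xs eqxx.
Qed.

Lemma norm_top_sum_le A (f : R -> R) k s :
  0 <= s -> f 0 = 0 -> (forall x y, 0 <= x <= y -> `|f x| <= `|f y|) ->
  (forall x, x \in singular_values A -> 0 <= x <= s) ->
  `|top_sum f k A| <= k%:R * `|f s|.
Proof.
move=> s0 f0 fm hs; rewrite /top_sum; apply: le_trans (ler_norm_sum _ _ _) _.
apply: (@le_trans _ _ (\sum_(i < k) `|f s|)); last first.
  by rewrite sumr_const card_ord mulr_natl.
apply: ler_sum => i _; have [si|si] := leqP (size (singular_values A)) i.
  by rewrite nth_default// fm ?lexx.
by apply/fm/hs; rewrite mem_nth.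
Qed.

End SingularValues.

Section StreamMatrix.
Context (R : realType) (n : nat).
Implicit Types (s : stream R n) (u y : 'rV[R]_n).

Lemma stream_mxE s i l :
  stream_mx s i l = \sum_(v <- s) v.2 * ((i == v.1.1) && (l == v.1.2))%:R.
Proof.
by rewrite /stream_mx summxE; apply: eq_bigr => v _; rewrite !mxE.
Qed.

Lemma mul_row_stream_mx y s l :
  (y *m stream_mx s) 0 l = \sum_(v <- s | v.1.2 == l) v.2 * y 0 v.1.1.
Proof.
rewrite mxE; under eq_bigr do rewrite stream_mxE big_distrr/=.
rewrite exchange_big [RHS]big_mkcond/=; apply: eq_bigr => v _.
rewrite (bigD1 v.1.1)//= big1 ?addr0 => [|i /negbTE ->]; last by rewrite !mulr0.
by rewrite eqxx eq_sym; case: eqP => _; rewrite ?mulr0// mulr1 mulrC.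
Qed.

Lemma mul_row_stream_mxT u s i :
  (u *m (stream_mx s)^T) 0 i = \sum_(v <- s | v.1.1 == i) v.2 * u 0 v.1.2.
Proof.
rewrite mxE; under eq_bigr do rewrite mxE stream_mxE big_distrr/=.
rewrite exchange_big [RHS]big_mkcond/=; apply: eq_bigr => v _.
rewrite (bigD1 v.1.2)//= big1 ?addr0 => [|l /negbTE ->]; last first.
  by rewrite andbF !mulr0.
by rewrite eqxx eq_sym andbT; case: eqP => _; rewrite ?mulr0// mulr1 mulrC.
Qed.

Lemma nnz_stream_mx s : (nnz (stream_mx s) <= size s)%N.
Proof.
rewrite /nnz -(size_map fst s); apply: leq_trans (card_size _).
apply: subset_leq_card; apply/fintype.subsetP => -[i l]; rewrite !inE/= stream_mxE.
apply: contraNT => sil; rewrite big1_seq// => v /= vs.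
case: andP => [[/eqP ii /eqP ll]|_]; last by rewrite mulr0.
by case/negP: sil; apply/mapP; exists v => //; rewrite ii ll -surjective_pairing.
Qed.

End StreamMatrix.

Lemma sqr_sum_le_weighted (R : realFieldType) (I : finType) (w v : I -> R) :
  (forall i, 0 < w i) -> \sum_i (w i)^-1 <= 1 ->
  (\sum_i v i) ^+ 2 <= \sum_i w i * v i ^+ 2.
Proof.
move=> w0 w1; set S := \sum_i v i.
have h i : 2 * S * v i - S ^+ 2 * (w i)^-1 <= w i * v i ^+ 2.
  have := w0 i; set x := w i => x0; rewrite -subr_ge0.
  have -> : x * v i ^+ 2 - (2 * S * v i - S ^+ 2 * x^-1) = x * (v i - S / x) ^+ 2.
    by field; rewrite gt_eqF.
  by rewrite mulr_ge0 ?sqr_ge0// ltW.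
apply: le_trans (ler_sum _ (fun i _ => h i)).
rewrite sumrB -!mulr_sumr -/S; have := sqr_ge0 S.
move: (\sum_i (w i)^-1) w1 => W; nra.
Qed.

Section BlockStream.
Context (R : realType) (n t : nat) (C B : finType) (iota : C + B -> 'I_n).
Hypothesis iota_inj : injective iota.

Definition diag_stream (d : C -> bool) : stream R n :=
  [seq ((iota (inl c), iota (inl c)), (d c)%:R) | c <- enum C].

Definition link_stream (act : pred B) (col : B -> 'I_t -> C) : stream R n :=
  [seq ((iota (inr q.1), iota (inl (col q.1 q.2))), 1)
     | q <- enum [pred q : B * 'I_t | act q.1]].

Context (d : C -> bool) (act : pred B) (col : B -> 'I_t -> C).
Hypothesis col_inj : forall b b' j j', act b -> act b' ->
  col b j = col b' j' -> (b, j) = (b', j').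

Let A := stream_mx (diag_stream d ++ link_stream act col).

Lemma mul_block_mxT_inl (u : 'rV[R]_n) c :
  (u *m A^T) 0 (iota (inl c)) = (d c)%:R * u 0 (iota (inl c)).
Proof.
rewrite mul_row_stream_mxT big_cat !big_map !big_enum_cond/=.
rewrite (big_pred1 c) => [|c']; last by rewrite /= (inj_eq iota_inj).
by rewrite big_pred0 ?addr0// => q; rewrite (inj_eq iota_inj) andbF.
Qed.

Lemma mul_block_mxT_inr (u : 'rV[R]_n) b :
  (u *m A^T) 0 (iota (inr b)) =
  (act b)%:R * \sum_j u 0 (iota (inl (col b j))).
Proof.
rewrite mul_row_stream_mxT big_cat !big_map !big_enum_cond/=.
rewrite big_pred0 ?add0r => [|c']; last by rewrite /= (inj_eq iota_inj).
under eq_bigl => q do rewrite (inj_eq iota_inj).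
rewrite (eq_bigl (fun q : B * 'I_t => ((q.1 == b) && act b) && true)); last first.
  move=> [b' j]; rewrite /= inE/= andbT andbC.
  have -> : (inr b' == inr b :> C + B) = (b' == b) by [].
  by case: eqP => // ->.
rewrite -(pair_big_dep (fun b' => (b' == b) && act b) (fun _ _ => true)
  (fun b' j => 1 * u 0 (iota (inl (col b' j)))))/=.
case: (act b); last by rewrite mul0r big_pred0// => b'; rewrite andbF.
rewrite mul1r (big_pred1 b) => [|b']; last by rewrite andbT.
by apply: eq_bigr => j _; rewrite mul1r.
Qed.

Lemma mul_block_mxT_out (u : 'rV[R]_n) i :
  i \notin codom iota -> (u *m A^T) 0 i = 0.
Proof.
move=> ni; rewrite mul_row_stream_mxT big_cat !big_map/=.
by rewrite !big_pred0 ?addr0// => q; apply/eqP => qi; rewrite -qi codom_f in ni.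
Qed.

Lemma sum_codom_iota (F : 'I_n -> R) : (forall i, i \notin codom iota -> F i = 0) ->
  \sum_i F i = \sum_c F (iota (inl c)) + \sum_b F (iota (inr b)).
Proof.
move=> F0; rewrite -(big_sumType _ xpredT (fun x => F (iota x))).
rewrite [RHS](partition_big iota predT)//; apply: eq_bigr => i _.
have [/codomP[x ->]|ni] := boolP (i \in codom iota).
  by rewrite (big_pred1 x) => [|x']; rewrite ?(inj_eq iota_inj).
by rewrite big_pred0 ?F0// => x; apply/eqP => xi; rewrite -xi codom_f in ni.
Qed.

Lemma sqr_norm_block_mxT (u : 'rV[R]_n) :
  \sum_i (u *m A^T) 0 i ^+ 2 =
  \sum_c (d c)%:R * u 0 (iota (inl c)) ^+ 2 +
  \sum_(b | act b) (\sum_j u 0 (iota (inl (col b j)))) ^+ 2.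
Proof.
rewrite sum_codom_iota => [|i ni]; last by rewrite mul_block_mxT_out// expr0n.
congr (_ + _).
  apply: eq_bigr => c _; rewrite mul_block_mxT_inl exprMn.
  by case: (d c); rewrite ?expr1n ?expr0n.
rewrite [RHS]big_mkcond; apply: eq_bigr => b _; rewrite mul_block_mxT_inr.
by case: (act b); rewrite ?mul1r// mul0r expr0n.
Qed.

Lemma singular_values_block_le lam : 1 <= lam ->
  (forall c, (d c)%:R < lam) ->
  (forall b, act b -> \sum_j (lam - (d (col b j))%:R)^-1 <= 1) ->
  forall s, s \in singular_values A -> 0 <= s <= Num.sqrt lam.
Proof.
move=> lam1 dlam hb; apply: mem_singular_values_le => u.
rewrite sqr_norm_block_mxT.
pose g c := (lam - (d c)%:R) * u 0 (iota (inl c)) ^+ 2.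
have g0 c : 0 <= g c by rewrite mulr_ge0 ?sqr_ge0// subr_ge0 ltW.
have h2 : \sum_(b | act b) (\sum_j u 0 (iota (inl (col b j)))) ^+ 2 <= \sum_c g c.
  apply: (@le_trans _ _ (\sum_(b | act b) \sum_j g (col b j))).
    apply: ler_sum => b ab; apply: sqr_sum_le_weighted; last exact: hb.
    by move=> j; rewrite subr_gt0.
  rewrite (pair_big act predT (fun b j => g (col b j)))/=.
  rewrite (partition_big (fun q => col q.1 q.2) predT)//=.
  apply: ler_sum => c _.
  have [[b j]|nq] := pickP (fun q => act q.1 && true && (col q.1 q.2 == c)).
    rewrite andbT/= => /andP[ab /eqP bj].
    rewrite (big_pred1 (b, j)) ?bj// => -[b' j']/=; rewrite andbT.
    apply/andP/eqP => [[ab' /eqP bj']|[-> ->]]; last by rewrite bj.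
    by apply: col_inj => //; rewrite bj.
  by rewrite big_pred0.
apply: (@le_trans _ _ (\sum_c lam * u 0 (iota (inl c)) ^+ 2)).
  rewrite -lerBrDl -sumrB; apply: le_trans h2 _.
  by apply: ler_sum => c _; rewrite -mulrBl.
rewrite mulr_sumr (bigID (mem (codom iota)))/=.
rewrite -[leLHS]addr0; apply: lerD; last first.
  by apply: sumr_ge0 => i _; rewrite mulr_ge0 ?sqr_ge0// (le_trans _ lam1).
rewrite [leRHS]big_mkcond sum_codom_iota/= => [|i /negbTE->//].
rewrite -[leLHS]addr0; apply: lerD.
  by apply: ler_sum => c _; rewrite codom_f.
by apply: sumr_ge0 => b _; rewrite codom_f mulr_ge0 ?sqr_ge0// (le_trans _ lam1).
Qed.

Lemma row_free_block_vectors (k : nat) (b : 'I_k -> B) :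
  injective b -> (forall a, act (b a)) -> (0 < t)%N ->
  row_free (\matrix_(a < k) \sum_j delta_mx 0 (iota (inl (col (b a) j))) : 'M[R]_(k, n)).
Proof.
move=> b_inj ab t0; set U := matrix_of_fun _ _.
apply/row_freeP; exists (\matrix_(i, a) (i == iota (inl (col (b a) (Ordinal t0))))%:R).
apply/matrixP => a a'; rewrite !mxE.
rewrite (bigD1 (iota (inl (col (b a') (Ordinal t0)))))//= big1 ?addr0; last first.
  by move=> i /negbTE ni; rewrite !mxE ni mulr0.
rewrite !mxE eqxx mulr1 summxE.
under eq_bigr do rewrite !mxE/= (inj_eq iota_inj).
have [<-|naa] := eqVneq a a'.
  rewrite (bigD1 (Ordinal t0))//= eqxx big1 ?addr0// => j jt.
  case: eqP => // -[] /col_inj-/(_ (ab _) (ab _))[] jj.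
  by rewrite jj eqxx in jt.
rewrite big1// => j _; case: eqP => // -[] /col_inj-/(_ (ab _) (ab _))[] /b_inj aa.
by rewrite aa eqxx in naa.
Qed.

Lemma mul_block_vector b : act b -> (forall j, d (col b j)) ->
  let v := \sum_j delta_mx 0 (iota (inl (col b j))) : 'rV[R]_n in
  v *m (A^T *m A) = (t%:R + 1) *: v.
Proof.
move=> ab db v; rewrite mulmxA.
have vl c : v 0 (iota (inl c)) = (c \in [seq col b j | j : 'I_t])%:R.
  rewrite summxE; under eq_bigr do rewrite !mxE/= (inj_eq iota_inj).
  have [/fintype.imageP[j _ ->]|nx] := boolP (c \in _).
    rewrite (bigD1 j)//= eqxx big1 ?addr0// => j' jj'.
    case: eqP => // -[] /col_inj-/(_ ab ab)[] e.
    by rewrite e eqxx in jj'.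
  rewrite big1// => j _; case: eqP => // -[cj]; case/negP: nx.
  by apply/fintype.imageP; exists j.
have vr b' : v 0 (iota (inr b')) = 0.
  by rewrite summxE big1// => j _; rewrite !mxE/= (inj_eq iota_inj).
have e_inr b' : (inr b' == inr b :> C + B) = (b' == b) by [].
set y := v + t%:R *: delta_mx 0 (iota (inr b)).
have yl c : y 0 (iota (inl c)) = (c \in [seq col b j | j : 'I_t])%:R.
  by rewrite mxE vl !mxE/= (inj_eq iota_inj)/= mulr0 addr0.
have yr b' : y 0 (iota (inr b')) = t%:R *+ (b' == b).
  by rewrite mxE vr !mxE/= (inj_eq iota_inj) e_inr mulr_natr add0r.
have -> : v *m A^T = y.
  apply/rowP => i; have [/codomP[[c|b'] ->]|ni] := boolP (i \in codom iota).
  - rewrite mul_block_mxT_inl yl vl.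
    have [/fintype.imageP[j _ ->]|_] := boolP (c \in _); last by rewrite mulr0.
    by rewrite db mulr1.
  - rewrite mul_block_mxT_inr yr; under eq_bigr do rewrite vl.
    have [->|nb] := eqVneq b' b.
      rewrite ab mul1r; under eq_bigr => j _ do rewrite fintype.image_f//.
      by rewrite sumr_const card_ord mulr1n.
    case: (boolP (act b')) => ab'; last by rewrite mul0r.
    rewrite mul1r big1// => j _; case: fintype.imageP => // -[j' _ e].
    by have [bb] := col_inj ab' ab e; rewrite bb eqxx in nb.
  - rewrite mul_block_mxT_out// mxE summxE big1 ?add0r => [|j _]; last first.
      by rewrite !mxE/=; case: eqP => // ij; rewrite ij codom_f in ni.
    by rewrite !mxE/=; case: eqP => [ij|]; [rewrite ij codom_f in ni|rewrite mulr0].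
apply/rowP => i; rewrite mul_row_stream_mx big_cat !big_map !big_enum_cond/= mxE.
have [/codomP[[c|b'] ->]|ni] := boolP (i \in codom iota).
- rewrite (big_pred1 c) => [|c']; last by rewrite /= (inj_eq iota_inj).
  rewrite yl vl; under eq_bigl => q do rewrite (inj_eq iota_inj).
  have [/fintype.imageP[j _ cj]|nc] := boolP (_ \in _).
    rewrite cj db !mulr1 (big_pred1 (b, j)) => [|[b' j']].
      by rewrite yr eqxx mulr1n mul1r addrC.
    rewrite inE/=; apply/andP/eqP => [[ab' /eqP[bj']]|[-> ->]//].
    exact: col_inj.
  rewrite !mulr0 add0r big1// => -[b' j] /=; rewrite inE/= => /andP[ab' /eqP[bj]].
  rewrite yr; case: eqP => [bb|]; last by rewrite mulr0.
  by case/negP: nc; apply/fintype.imageP; exists j; rewrite // -bj bb.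
- by rewrite vr mulr0 !big_pred0 ?addr0 => [|q|c]; rewrite ?(inj_eq iota_inj) ?andbF.
- rewrite [RHS](_ : _ = 0); last first.
    rewrite summxE big1 ?mulr0// => j _; rewrite !mxE/=.
    by case: eqP => // ij; rewrite ij codom_f in ni.
  rewrite !big_pred0 ?addr0// => q; apply/negP.
    by move=> /andP[_ /eqP qi]; rewrite -qi codom_f in ni.
  by move=> /eqP qi; rewrite -qi codom_f in ni.
Qed.

End BlockStream.

(** * One-way communication *)

Lemma expRD_expRN_le (R : realType) (x : R) :
  expR x + expR (- x) <= 2 * expR (2 * x ^+ 2).
Proof.
wlog x0 : x / 0 <= x => [hw|].
  have [/hw//|x0] := lerP 0 x.
  by have := hw (- x); rewrite opprK sqrrN addrC; apply; rewrite oppr_ge0 ltW.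
have [xh|xh] := lerP (x ^+ 2) 2^-1; last first.
  have x1 : x <= 2 * x ^+ 2 by have := sqr_ge0 (x - 2^-1); nra.
  have : expR x <= expR (2 * x ^+ 2) by rewrite ler_expR.
  have : expR (- x) <= expR x by rewrite ler_expR; lra.
  lra.
have inv_le (y : R) : y < 1 -> expR y <= (1 - y)^-1.
  move=> y1; rewrite -[y]opprK expRN lef_pV2 ?posrE ?expR_gt0 ?opprK ?subr_gt0//.
  by rewrite -[leLHS]/(1 + - y) expR_ge1Dx.
have x1 : x < 1 by nra.
have h1 := inv_le _ x1; have h2 : expR (- x) <= (1 + x)^-1.
  by have := inv_le (- x); rewrite opprK; apply; lra.
have h3 : 1 + 2 * x ^+ 2 <= expR (2 * x ^+ 2) by exact: expR_ge1Dx.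
have : (1 - x)^-1 + (1 + x)^-1 <= 2 * (1 + 2 * x ^+ 2).
  have -> : (1 - x)^-1 + (1 + x)^-1 = 2 / (1 - x ^+ 2).
    by field; rewrite !gt_eqF//; nra.
  by rewrite ler_pdivrMr; nra.
lra.
Qed.

Section CubeMoment.
Context (R : realType).

Lemma sum_ffun_ord_recl (T : finType) n (F : {ffun 'I_n.+1 -> T} -> R) :
  \sum_z F z =
  \sum_b \sum_(z : {ffun 'I_n -> T})
    F [ffun i => if unlift ord0 i is Some j then z j else b].
Proof.
rewrite pair_big/=.
pose u (p : T * {ffun 'I_n -> T}) : {ffun 'I_n.+1 -> T} :=
  [ffun i => if unlift ord0 i is Some j then p.2 j else p.1].
rewrite (reindex u)//=; exists (fun z => (z ord0, [ffun j => z (lift ord0 j)])).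
  move=> [b z] _; rewrite /u /= ffunE unlift_none; congr (_, _).
  by apply/ffunP => j; rewrite !ffunE liftK.
move=> z _; apply/ffunP => i; rewrite ffunE.
by case: unliftP => [j ->|->]; rewrite ?ffunE.
Qed.

(* Averaging over one sign replaces 1/L by 1/(L - 8), as
   cosh y <= exp (2 y^2). *)
Lemma sum_cube_expR_sqr_le n (c : 'I_n -> R) (L s : R) :
  (forall i, c i ^+ 2 = 1) -> 8 * n%:R < L ->
  \sum_(z : {ffun 'I_n -> bool}) expR ((s + \sum_i c i * (-1) ^+ z i) ^+ 2 / L)
    <= 2 ^+ n * expR ((n%:R + s ^+ 2) / (L - 8 * n%:R)).
Proof.
elim: n c s => [|n IH] c s hc hL.
  rewrite (eq_bigr (fun=> expR (s ^+ 2 / L))) => [|z _]; last first.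
    by rewrite big_ord0 addr0.
  by rewrite sumr_const card_ffun card_ord expn0 mulr1n expr0 mul1r mulr0 subr0 add0r.
rewrite sum_ffun_ord_recl.
have hL' : 8 * n%:R < L by move: hL; rewrite -natr1; lra.
set a := (L - 8 * n%:R)^-1.
have step (b : bool) : \sum_(z : {ffun 'I_n -> bool})
    expR ((s + \sum_i c i * (-1) ^+ ([ffun i => if unlift ord0 i is Some j
      then z j else b] : {ffun 'I_n.+1 -> bool}) i) ^+ 2 / L) <=
    2 ^+ n * expR ((n%:R + (s + c ord0 * (-1) ^+ b) ^+ 2) * a).
  apply: le_trans (IH (fun i => c (lift ord0 i)) _ _ _) => //.
  apply: ler_sum => z _; rewrite ler_expR le_eqVlt; apply/predU1P; left; congr (_ ^+ 2 / L).
  rewrite big_ord_recl ffunE unlift_none addrA; congr (_ + _).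
  by apply: eq_bigr => i _; rewrite ffunE liftK.
rewrite big_bool; apply: le_trans (lerD (step _) (step _)) _.
rewrite expr0 [(-1) ^+ true]expr1 mulrN1 mulr1 -mulrDr (exprSr _ n) -mulrA ler_pM2l ?exprn_gt0//.
have a0 : 0 < a by rewrite invr_gt0 subr_gt0.
set a' := (L - 8 * n.+1%:R)^-1.
have a'0 : 0 < a' by rewrite invr_gt0 subr_gt0.
have haa : a' = a + 8 * a * a'.
  by rewrite /a /a' -natr1; field; rewrite !gt_eqF//; move: hL; rewrite -natr1; lra.
have h0 := hc ord0; set x := c ord0 in h0 *.
have -> : (n%:R + (s - x) ^+ 2) * a = (n%:R + s ^+ 2 + 1) * a + - (2 * s * x * a).
  by rewrite sqrrB h0; ring.
have -> : (n%:R + (s + x) ^+ 2) * a = (n%:R + s ^+ 2 + 1) * a + 2 * s * x * a.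
  by rewrite sqrrD h0; ring.
rewrite !expRD -mulrDr [X in _ * X]addrC.
apply: le_trans (ler_wpM2l (expR_ge0 _) (expRD_expRN_le _)) _.
rewrite mulrCA ler_pM2l// -expRD ler_expR.
have -> : 2 * (2 * s * x * a) ^+ 2 = 8 * s ^+ 2 * a ^+ 2 * x ^+ 2 by ring.
rewrite h0 mulr1 -natr1.
have s2 := sqr_ge0 s; have n0 : 0 <= n%:R :> R by [].
have le1 : a <= a' by move: haa; nra.
have le2 : 8 * a ^+ 2 <= a' - a.
  have : 0 <= a * (a' - a) by apply: mulr_ge0; [exact: ltW|rewrite subr_ge0].
  by move: haa; nra.
have := ler_wpM2l n0 le1; have := ler_wpM2l s2 le2; nra.
Qed.

End CubeMoment.

Section HypergraphSums.
Context (R : realType) (N m t : nat).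

Definition edge_parity (x : {ffun 'I_N -> bool}) (e : {ffun 'I_t -> 'I_N}) :=
  \big[addb/false]_j x (e j).

Definition parities (M : {ffun 'I_m -> {ffun 'I_t -> 'I_N}})
    (x : {ffun 'I_N -> bool}) : {ffun 'I_m -> bool} :=
  [ffun a => edge_parity x (M a)].

Lemma sum_hypergraph_prod (c : 'I_N -> R) :
  \sum_(M : {ffun 'I_m -> {ffun 'I_t -> 'I_N}})
    \prod_a (1 + \prod_j c (M a j)) = (N%:R ^+ t + (\sum_v c v) ^+ t) ^+ m.
Proof.
rewrite -(bigA_distr_bigA (fun (_ : 'I_m) (e : {ffun 'I_t -> 'I_N}) =>
  1 + \prod_j c (e j))) prodr_const card_ord.
congr (_ ^+ _); rewrite big_split/= sumr_const card_ffun !card_ord natrX.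
congr (_ + _); rewrite -(bigA_distr_bigA (fun (_ : 'I_t) v => c v)).
by rewrite prodr_const card_ord.
Qed.

Lemma parities_eq_prod (M : {ffun 'I_m -> {ffun 'I_t -> 'I_N}})
    (x y : {ffun 'I_N -> bool}) :
  2 ^+ m * (parities M x == parities M y)%:R =
  \prod_a (1 + \prod_j ((-1) ^+ x (M a j) * (-1) ^+ y (M a j))) :> R.
Proof.
have sgn (z : {ffun 'I_N -> bool}) (e : {ffun 'I_t -> 'I_N}) :
    \prod_j (-1) ^+ z (e j) = (-1) ^+ edge_parity z e :> R.
  have s0 : (-1) ^+ false = 1 :> R by [].
  by rewrite /edge_parity (big_morph _ (@signr_addb R) s0).
under eq_bigr => a _ do rewrite big_split/= !sgn -signr_addb.
have [/ffunP e|ne] := eqVneq.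
  rewrite mulr1 -[X in 2 ^+ X]card_ord -prodr_const; apply: eq_bigr => a _.
  by have := e a; rewrite !ffunE => ->; rewrite addbb.
have [a na] : exists a, edge_parity x (M a) != edge_parity y (M a).
  apply/existsP; rewrite -negb_forall; apply: contra ne => /forallP e.
  by apply/eqP/ffunP => a; rewrite !ffunE; exact/eqP.
rewrite mulr0 (bigD1 a)//=; move: na.
by case: edge_parity; case: edge_parity => //= _; rewrite expr1 subrr mul0r.
Qed.

End HypergraphSums.

Lemma sum_fiber (R : realType) (X W : finType) (A : pred X) (g : X -> W)
    (F : W -> R) :
  \sum_(x | A x) F (g x) = \sum_w (\sum_(x | A x) (g x == w)%:R) * F w.
Proof.
under [RHS]eq_bigr do rewrite big_distrl/=.
rewrite exchange_big/=; apply: eq_bigr => x _.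
rewrite (bigD1 (g x))//= eqxx mul1r big1 ?addr0// => w /negbTE.
by rewrite eq_sym => ->; rewrite mul0r.
Qed.

Lemma sum_collisions (R : realType) (X W : finType) (A : pred X) (g : X -> W) :
  \sum_(x | A x) \sum_(y | A y) (g x == g y)%:R =
  \sum_w (\sum_(x | A x) (g x == w)%:R) ^+ 2 :> R.
Proof.
rewrite exchange_big (sum_fiber A g (fun w => \sum_(x | A x) (g x == w)%:R)).
by apply: eq_bigr => w _; exact: esym (expr2 _).
Qed.

Lemma sqr_card_le_collisions (R : realType) (X W : finType) (A : pred X)
    (g : X -> W) :
  #|A|%:R ^+ 2 <=
  #|W|%:R * (\sum_(x | A x) \sum_(y | A y) (g x == g y)%:R) :> R.
Proof.
rewrite sum_collisions; pose n w : R := \sum_(x | A x) (g x == w)%:R.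
set a : R := #|A|%:R; set K : R := #|W|%:R.
have n1 : \sum_w n w = a.
  have := sum_fiber A g (fun=> 1 : R); under [in RHS]eq_bigr do rewrite mulr1.
  by move=> <-; rewrite sumr_const.
have : 0 <= \sum_w (K * n w - a) ^+ 2 by apply: sumr_ge0 => w _; exact: sqr_ge0.
have -> : \sum_w (K * n w - a) ^+ 2 = K * (K * (\sum_w n w ^+ 2) - a ^+ 2).
  rewrite (eq_bigr (fun w => K ^+ 2 * n w ^+ 2 - 2 * K * a * n w + a ^+ 2)).
    rewrite !big_split/= sumrN sumr_const -!mulr_sumr n1.
    by rewrite -(mulr_natr (a ^+ 2)) -/K; ring.
  by move=> w _; ring.
have [K0|K0] := eqVneq K 0.
  have : a = 0.
    have W0 : #|W| = 0%N by apply/eqP; rewrite -(pnatr_eq0 R); apply/eqP.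
    by rewrite -n1 big1// => w _; have := card0_eq W0 w.
  by move=> ->; rewrite K0 expr0n/= !mul0r.
by rewrite pmulr_rge0 ?subr_ge0// lt_def K0 ler0n.
Qed.

Lemma guess_bit_le (R : realType) (X W : finType) (A : pred X) (g : X -> W)
    (flip : W -> W) (D : W -> bool) (th : R) :
  involutive flip -> 0 < th ->
  \sum_(x | A x) ((~~ D (g x))%:R + (D (flip (g x)))%:R) <=
  #|A|%:R * (1 + th / 2) +
  (#|W|%:R * (\sum_(x | A x) \sum_(y | A y) (g x == g y)%:R) - #|A|%:R ^+ 2)
    / (2 * th * #|A|%:R).
Proof.
move=> flipK th0; set a : R := #|A|%:R; set K : R := #|W|%:R.
have [a0|a0] := eqVneq a 0.
  have A0 : #|A| = 0%N by apply/eqP; rewrite -(pnatr_eq0 R); apply/eqP.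
  rewrite a0 mul0r mulr0 invr0 mulr0 addr0 big_pred0// => x.
  by have := card0_eq A0 x; rewrite inE.
have apos : 0 < a by rewrite lt_def a0 ler0n.
pose n w : R := \sum_(x | A x) (g x == w)%:R.
have n1 : \sum_w n w = a.
  have := sum_fiber A g (fun=> 1 : R); under [in RHS]eq_bigr do rewrite mulr1.
  by move=> <-; rewrite sumr_const.
have K0 : 0 < K.
  rewrite ltr0n; have /card_gt0P[x _] : (0 < #|A|)%N by rewrite -(ltr0n R).
  by apply/card_gt0P; exists (g x).
pose d w : R := (D (flip w))%:R - (D w)%:R.
have d0 : \sum_w d w = 0.
  by rewrite sumrB [X in X - _](reindex_inj (inv_inj flipK))/=;
     under eq_bigr do rewrite flipK; rewrite subrr.
have -> : \sum_(x | A x) ((~~ D (g x))%:R + (D (flip (g x)))%:R) =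
    a + \sum_w (n w - a / K) * d w.
  rewrite (eq_bigr (fun x => 1 + d (g x))) => [|x _]; last first.
    by rewrite /d; case: (D (g x)); rewrite /=; ring.
  rewrite big_split/= sumr_const; congr (_ + _).
  rewrite (sum_fiber A g d); under [RHS]eq_bigr do rewrite mulrBl.
  by rewrite sumrB -mulr_sumr d0 mulr0 subr0.
pose s := th * a / K; have s0 : 0 < s by rewrite divr_gt0// mulr_gt0.
rewrite mulrDr mulr1 -addrA lerD2l.
apply: (@le_trans _ _ (\sum_w ((n w - a / K) ^+ 2 / (2 * s) + s / 2))).
  apply: ler_sum => w _; set x := n w - _.
  have d1 : d w ^+ 2 <= 1.
    by rewrite /d; case: (D w); case: (D _); rewrite ?subrr ?expr0n ?subr0 ?sub0r ?sqrrN ?expr1n.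
  rewrite -subr_ge0.
  have -> : x ^+ 2 / (2 * s) + s / 2 - x * d w =
      (x - s * d w) ^+ 2 / (2 * s) + s / 2 * (1 - d w ^+ 2).
    by field; rewrite gt_eqF.
  by apply: addr_ge0; [apply: divr_ge0; [exact: sqr_ge0|lra]|apply: mulr_ge0; lra].
rewrite big_split/= sumr_const -mulr_suml sum_collisions.
under eq_bigr do rewrite sqrrB.
rewrite !big_split/= sumrN sumr_const.
under [X in _ - X]eq_bigr do rewrite -mulrnAl.
rewrite -mulr_suml sumrMnl n1 -(mulr_natr ((a / K) ^+ 2)) -(mulr_natr (s / 2)) -/K /s.
rewrite le_eqVlt; apply/predU1P; left; field.
by rewrite !gt_eqF.
Qed.

Lemma sum_parities_collisions (R : realType) N m t (x y : {ffun 'I_N -> bool}) :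
  2 ^+ m * \sum_(M : {ffun 'I_m -> {ffun 'I_t -> 'I_N}})
    (parities M x == parities M y)%:R =
  (N%:R ^+ t + (\sum_v (-1) ^+ x v * (-1) ^+ y v) ^+ t) ^+ m :> R.
Proof.
rewrite mulr_sumr; under eq_bigr do rewrite parities_eq_prod.
exact: sum_hypergraph_prod.
Qed.

Lemma expr_excess_le (R : realType) (m h : nat) (L q r dl : R) :
  (0 < h)%N -> 0 <= q <= 1 -> 32 * m%:R <= L ->
  0 <= dl -> (1 + r ^+ h) ^+ m <= 1 + dl ->
  (1 + q ^+ h) ^+ m - 1 <= dl + expR (L * q / 16 - L * r / 32).
Proof.
move=> h0 /andP[q0 q1] mL dl0 hr; have [qr|rq] := lerP q r.
  have : (1 + q ^+ h) ^+ m <= (1 + r ^+ h) ^+ m.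
    rewrite lerXn2r ?nnegrE ?addr_ge0 ?exprn_ge0 ?(le_trans q0)//.
    by rewrite lerD2l lerXn2r ?nnegrE// (le_trans q0).
  by have := expR_ge0 (L * q / 16 - L * r / 32); lra.
have qh : q ^+ h <= q.
  by case: h h0 {hr} => // h _; rewrite exprS ler_piMr// exprn_ile1.
have : (1 + q ^+ h) ^+ m <= expR (m%:R * q).
  rewrite expRM_natl.
  rewrite lerXn2r ?nnegrE ?expR_ge0 ?addr_ge0 ?exprn_ge0//.
  by apply: le_trans (expR_ge1Dx _); rewrite lerD2l.
have : expR (m%:R * q) <= expR (L * q / 16 - L * r / 32).
  by rewrite ler_expR; have : (0 : R) <= m%:R by []; nra.
lra.
Qed.

Lemma expRV8_le2 (R : realType) : expR (8^-1 : R) <= 2.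
Proof.
rewrite -[8^-1]opprK expRN invf_ple ?posrE ?expR_gt0//.
by apply: le_trans (expR_ge1Dx _); lra.
Qed.

Lemma sum_excess_le (R : realType) N m h (x : {ffun 'I_N -> bool})
    (A : pred {ffun 'I_N -> bool}) (r dl : R) :
  (0 < N)%N -> (0 < h)%N -> (32 * m <= N)%N ->
  0 <= dl -> (1 + r ^+ h) ^+ m <= 1 + dl ->
  \sum_(y | A y)
    ((N%:R ^+ h.*2 + (\sum_v (-1) ^+ x v * (-1) ^+ y v) ^+ h.*2) ^+ m
      - (N%:R ^+ h.*2) ^+ m) <=
  (N%:R ^+ h.*2) ^+ m *
    (dl * #|A|%:R + 2 * 2 ^+ N * expR (- (N%:R * r / 32))).
Proof.
move=> N0 h0 mN dl0 hr; pose L : R := N%:R; rewrite -/L.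
have L0 : 0 < L by rewrite ltr0n.
have mL : 32 * m%:R <= L by rewrite -natrM ler_nat.
pose S (y : {ffun 'I_N -> bool}) : R := \sum_v (-1) ^+ x v * (-1) ^+ y v.
pose q y := (S y / L) ^+ 2.
have q01 y : 0 <= q y <= 1.
  rewrite sqr_ge0/= -[q y]real_normK ?num_real// expr_le1// normrM.
  rewrite [`|L^-1|]gtr0_norm ?invr_gt0// ler_pdivrMr// mul1r.
  apply: le_trans (ler_norm_sum _ _ _) _.
  under eq_bigr do rewrite -signr_addb normr_sign.
  by rewrite sumr_const card_ord.
have term y : (L ^+ h.*2 + S y ^+ h.*2) ^+ m - (L ^+ h.*2) ^+ m <=
    (L ^+ h.*2) ^+ m * (dl + expR (S y ^+ 2 / (16 * L)) * expR (- (L * r / 32))).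
  have -> : L ^+ h.*2 + S y ^+ h.*2 = L ^+ h.*2 * (1 + q y ^+ h).
    rewrite /q -exprM mul2n expr_div_n; field.
    by rewrite expf_neq0// gt_eqF.
  rewrite exprMn -[X in _ - X]mulr1 -mulrBr ler_pM2l ?exprn_gt0//.
  apply: le_trans (expr_excess_le h0 (q01 y) mL dl0 hr) _.
  rewrite lerD2l -expRD ler_expR le_eqVlt; apply/predU1P; left.
  by rewrite /q; field; rewrite gt_eqF.
apply: (le_trans (ler_sum _ (fun y _ => term y))).
rewrite -mulr_sumr ler_pM2l ?exprn_gt0// big_split/= sumr_const.
rewrite -[dl *+ _]mulr_natr lerD2l -mulr_suml ler_pM2r ?expR_gt0//.
apply: (@le_trans _ _ (\sum_y expR (S y ^+ 2 / (16 * L)))).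
  rewrite [leLHS]big_mkcond; apply: ler_sum => y _.
  by case: ifP => // _; exact: expR_ge0.
have hc i : ((-1) ^+ x i) ^+ 2 = 1 :> R by rewrite -exprM mulnC exprM sqrrN !expr1n.
have := sum_cube_expR_sqr_le 0 hc (_ : 8 * L < 16 * L).
under eq_bigr do rewrite add0r; move=> /(_ _)/le_trans; apply.
  by rewrite ltr_pM2r//; lra.
rewrite mulrC ler_pM2r ?exprn_gt0// expr0n addr0.
have -> : L / (16 * L - 8 * L) = 8^-1 by field; rewrite gt_eqF//; lra.
exact: expRV8_le2.
Qed.

Definition shift_parities m (c : bool) (w : {ffun 'I_m -> bool}) :=
  [ffun a => w a (+) c].

Lemma shift_paritiesK m c : involutive (@shift_parities m c).
Proof. by move=> w; apply/ffunP => a; rewrite !ffunE addbK. Qed.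

Lemma shift_parities_false m : @shift_parities m false =1 id.
Proof. by move=> w; apply/ffunP => a; rewrite ffunE addbF. Qed.

Lemma one_way_success_le (R : realType) N m h (T : finType)
    (msg : {ffun 'I_N -> bool} -> T)
    (dec : T -> {ffun 'I_m -> {ffun 'I_h.*2 -> 'I_N}} -> {ffun 'I_m -> bool} -> bool)
    (G : pred {ffun 'I_m -> {ffun 'I_h.*2 -> 'I_N}}) (r dl th : R) :
  (0 < N)%N -> (0 < h)%N -> (32 * m <= N)%N ->
  0 <= dl -> (1 + r ^+ h) ^+ m <= 1 + dl -> 0 < th ->
  \sum_(M | G M) \sum_x \sum_c
    (dec (msg x) M (shift_parities c (parities M x)) == c)%:R <=
  2 ^+ N * (#|G|%:R * (1 + th / 2) +
    (N%:R ^+ h.*2) ^+ m / (2 * th) *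
      (dl + 2 * #|T|%:R * expR (- (N%:R * r / 32)))).
Proof.
move=> N0 h0 mN dl0 hr th0.
pose A tau := [pred x : {ffun 'I_N -> bool} | msg x == tau].
pose Q tau (M : {ffun 'I_m -> {ffun 'I_h.*2 -> 'I_N}}) : R :=
  #|{: {ffun 'I_m -> bool}}|%:R * (\sum_(x | A tau x) \sum_(y | A tau y)
    (parities M x == parities M y)%:R) - #|A tau|%:R ^+ 2.
have Q0 tau M : 0 <= Q tau M by rewrite subr_ge0 sqr_card_le_collisions.
have sumA : \sum_tau #|A tau|%:R = 2 ^+ N :> R.
  have -> : 2 ^+ N = (\sum_(x : {ffun 'I_N -> bool}) 1)%:R :> R.
    by rewrite sum1_card card_ffun card_bool card_ord natrX.
  rewrite (partition_big msg xpredT)//= natr_sum.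
  by apply: eq_bigr => tau _; rewrite sum1_card.
have step M : \sum_x \sum_c
      (dec (msg x) M (shift_parities c (parities M x)) == c)%:R <=
    \sum_tau (#|A tau|%:R * (1 + th / 2) + Q tau M / (2 * th * #|A tau|%:R)).
  rewrite (partition_big msg xpredT)//=; apply: ler_sum => tau _.
  apply: le_trans (guess_bit_le (A tau) (parities M) (dec tau M)
    (@shift_paritiesK m true) th0).
  apply: ler_sum => x /eqP <-.
  by rewrite big_bool/= shift_parities_false addrC eqbF_neg eqb_id.
apply: (le_trans (ler_sum _ (fun M _ => step M))).
rewrite exchange_big/=; pose mu : R := (N%:R ^+ h.*2) ^+ m.
pose e := expR (- (N%:R * r / 32)) : R.
apply: (@le_trans _ _ (\sum_tau (#|G|%:R * (1 + th / 2) * #|A tau|%:R +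
    mu / (2 * th) * (dl * #|A tau|%:R + 2 * 2 ^+ N * e)))).
  apply: ler_sum => tau _; rewrite big_split/= sumr_const.
  rewrite -(mulr_natl (_ * (1 + th / 2))) mulrCA (mulrC #|A tau|%:R) lerD2l.
  apply: (@le_trans _ _ (\sum_M Q tau M / (2 * th * #|A tau|%:R))).
    rewrite [leLHS]big_mkcond; apply: ler_sum => M _; case: ifP => // _.
    by rewrite divr_ge0// mulr_ge0// mulr_ge0// ltW.
  rewrite -mulr_suml.
  have [a0|a0] := eqVneq (#|A tau|%:R : R) 0.
    rewrite a0 !mulr0 invr0 mulr0 add0r.
    apply: mulr_ge0; first by rewrite divr_ge0 ?exprn_ge0//; lra.
    by apply: mulr_ge0; [rewrite mulr_ge0 ?exprn_ge0|exact: expR_ge0].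
  have a1 : 0 < #|A tau|%:R :> R by rewrite lt_def a0 ler0n.
  have -> : \sum_M Q tau M = \sum_(x | A tau x) \sum_(y | A tau y)
      ((N%:R ^+ h.*2 + (\sum_v (-1) ^+ x v * (-1) ^+ y v) ^+ h.*2) ^+ m - mu).
    rewrite sumrB sumr_const !card_ffun !card_ord card_bool natrX.
    under [RHS]eq_bigr do rewrite sumrB sumr_const.
    rewrite [RHS]sumrB sumr_const; congr (_ - _); last first.
      rewrite -(mulr_natr (_ ^+ 2)) -(mulrnA mu) -(mulr_natr mu) !natrX.
      by rewrite mulrC natrM expr2.
    rewrite -mulr_sumr exchange_big/= mulr_sumr; apply: eq_bigr => x _.
    rewrite exchange_big/= mulr_sumr; apply: eq_bigr => y _.
    by rewrite sum_parities_collisions.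
  rewrite ler_pdivrMr ?mulr_gt0//.
  apply: le_trans (ler_sum _ (fun x _ => sum_excess_le x (A tau) N0 h0 mN dl0 hr)) _.
  rewrite sumr_const -/mu -/e -(mulr_natr (mu * _)) le_eqVlt; apply/predU1P; left.
  rewrite -[LHS]/(mu * (dl * #|A tau|%:R + 2 * 2 ^+ N * e) * #|A tau|%:R).
  by field; rewrite gt_eqF.
rewrite big_split/= -!mulr_sumr big_split/= -mulr_sumr sumA sumr_const.
rewrite -(mulr_natr (2 * 2 ^+ N * e)) -/mu -/e le_eqVlt; apply/predU1P; left.
rewrite -[X in _ * X + _ = _]/(2 ^+ N).
by field; rewrite gt_eqF.
Qed.

Section Isolation.
Local Open Scope nat_scope.
Context (N m t : nat).
Local Notation hyper := {ffun 'I_m -> {ffun 'I_t -> 'I_N}}.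

Definition isolated_edge (M : hyper) (a : 'I_m) : bool :=
  [forall j, forall b, forall j', (M a j == M b j') ==> ((a, j) == (b, j'))].

Definition well_spread (M : hyper) : bool := m <= 2 * #|[pred a | isolated_edge M a]|.

Lemma card_coincidence (p q : 'I_m * 'I_t) : p != q ->
  #|[set M : hyper | M p.1 p.2 == M q.1 q.2]| * N <= #|{: hyper}|.
Proof.
move=> pq; rewrite -[N in _ * N]card_ord -finset.cardsT -finset.cardsX.
pose upd (M : hyper) c : hyper :=
  [ffun a => [ffun j => if (a, j) == p then c else M a j]].
have updE M c a j : upd M c a j = if (a, j) == p then c else M a j by rewrite !ffunE.
have upd_inj : {in finset.setX [set M : hyper | M p.1 p.2 == M q.1 q.2] finset.setT &,
    injective (fun Mc => upd Mc.1 Mc.2)}.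
  move=> [M c] [M' c'] /finset.setXP[/= + _] /finset.setXP[/= + _].
  rewrite !finset.in_set => /eqP Mpq' /eqP Mpq /ffunP e.
  have e' a j : upd M c a j = upd M' c' a j by rewrite e.
  have cc : c = c' by have := e' p.1 p.2; rewrite !updE -surjective_pairing eqxx.
  have off x : x != p -> M x.1 x.2 = M' x.1 x.2.
    by case: x => a j /negbTE np; have := e' a j; rewrite !updE np.
  congr (_, _) => //; apply/ffunP => a; apply/ffunP => j.
  have [ap|/off//] := eqVneq (a, j) p.
  by move: Mpq Mpq'; rewrite -ap/= => -> ->; apply: off; rewrite eq_sym.
by rewrite -(card_in_imset upd_inj) max_card.
Qed.

Lemma card_well_spread : 4 * m * t ^ 2 <= N -> 0 < t ->
  #|{: hyper}| <= 2 * #|[pred M | well_spread M]|.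
Proof.
move=> hN t0; have [m0|m0] := posnP m.
  rewrite mul2n -addnn (leq_trans _ (leq_addr _ _))// subset_leq_card//.
  by apply/fintype.subsetP => M _; rewrite inE /well_spread [leqLHS]m0.
have noniso (M : hyper) : #|[pred a | ~~ isolated_edge M a]| <=
    \sum_(p : 'I_m * 'I_t) \sum_(q | q != p) (M p.1 p.2 == M q.1 q.2).
  rewrite -sum1_card big_mkcond -(pair_bigA _ (fun a j =>
    \sum_(q | q != (a, j)) (M a j == M q.1 q.2)))/=.
  apply: leq_sum => a _; rewrite inE; case: ifP => // /forallPn[j].
  move=> /forallPn[b] /forallPn[j']; rewrite negb_imply => /andP[/eqP e ne].
  rewrite (bigD1 j)//= (bigD1 (b, j'))/=; last by rewrite eq_sym.
  by rewrite e eqxx.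
have total : N * \sum_(M : hyper) #|[pred a | ~~ isolated_edge M a]| <=
    (m * t) ^ 2 * #|{: hyper}|.
  apply: (@leq_trans (N * \sum_(p : 'I_m * 'I_t) \sum_(q | q != p)
      \sum_(M : hyper) (M p.1 p.2 == M q.1 q.2))).
    rewrite leq_mul2l; apply/orP; right.
    apply: (@leq_trans (\sum_(M : hyper) \sum_(p : 'I_m * 'I_t)
        \sum_(q | q != p) (M p.1 p.2 == M q.1 q.2))).
      by apply: leq_sum => M _; exact: noniso.
    rewrite exchange_big/=; apply: leq_sum => p _.
    by rewrite exchange_big.
  rewrite big_distrr/=; under eq_bigr do rewrite big_distrr/=.
  apply: (@leq_trans (\sum_(p : 'I_m * 'I_t) \sum_(q : 'I_m * 'I_t) #|{: hyper}|)).
    apply: leq_sum => p _; rewrite [leqLHS]big_mkcond; apply: leq_sum => q _.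
    case: ifP => // qp; rewrite -big_mkcond/= sum1_card mulnC.
    have := @card_coincidence p q; rewrite eq_sym qp => /(_ isT).
    by rewrite cardsE.
  by rewrite !sum_nat_const card_prod !card_ord mulnA -mulnn.
have bad : m * #|[pred M : hyper | ~~ well_spread M]| <=
    2 * \sum_(M : hyper) #|[pred a | ~~ isolated_edge M a]|.
  rewrite -sum1_card !big_distrr/= big_mkcond; apply: leq_sum => M _.
  rewrite inE /well_spread; case: ifP => //; rewrite -ltnNge muln1.
  have := cardC [pred a | isolated_edge M a]; rewrite card_ord.
  set i := #|_|; have -> : #|[predC [pred a | isolated_edge M a]]| =
    #|[pred a | ~~ isolated_edge M a]| by apply: eq_card => a; rewrite !inE.
  move: #|[pred a | ~~ isolated_edge M a]| => n; lia.
have good := cardC [pred M : hyper | well_spread M].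
have {}good : #|[pred M : hyper | well_spread M]| +
    #|[pred M : hyper | ~~ well_spread M]| = #|{: hyper}|.
  by rewrite -good; congr (_ + _); apply: eq_card => M; rewrite !inE.
set B := #|[pred M : hyper | ~~ well_spread M]| in bad good.
set H := #|{: hyper}| in good total *.
have : 4 * m * t ^ 2 * (m * B) <= 2 * ((m * t) ^ 2 * H).
  apply: leq_trans (leq_mul hN bad) _.
  by rewrite mulnCA leq_mul2l total orbT.
have -> : 4 * m * t ^ 2 * (m * B) = 2 * ((m * t) ^ 2 * (2 * B)) by rewrite expnMn; ring.
rewrite !leq_pmul2l ?expn_gt0 ?muln_gt0 ?m0 ?t0//.
by lia.
Qed.

End Isolation.

(** * The streaming lower bound *)

Local Open Scope classical_set_scope.
Local Open Scope ring_scope.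

Section Derandomization.
Context (R : realType) (d : measure_display) (Om : measurableType d).

Lemma exists_good_seed (P : probability Om R) (I : finType) (Q : pred I)
    (A : I -> set Om) (p : R) :
  (forall i, measurable (A i)) ->
  (forall i, Q i -> (p%:E <= P (A i))%E) ->
  exists w, p * #|Q|%:R <= \sum_(i | Q i) (w \in A i)%:R.
Proof.
move=> mA pA; apply: contrapT => hw.
pose cnt w := (\sum_(i | Q i) (w \in A i : nat))%N.
have cntE w : (cnt w)%:R = \sum_(i | Q i) (w \in A i)%:R :> R by rewrite natr_sum.
have bound w : (cnt w <= #|Q|)%N.
  by rewrite -sum1_card; apply: leq_sum => i _; exact: leq_b1.
have [w0 _] : [set: Om] !=set0.
  by apply/set0P/eqP => T0; have := @probability_setT _ _ _ P;
    rewrite T0 measure0 => /esym/eqP; rewrite onee_eq0.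
have exc : exists n, `[< exists w, cnt w = n >] by exists (cnt w0); apply/asboolP; exists w0.
have ubc n : `[< exists w, cnt w = n >] -> (n <= #|Q|)%N.
  by move=> /asboolP[w <-].
case: (ex_maxnP exc ubc) => c /asboolP[w1 w1c] cmax.
have cle w : (cnt w <= c)%N by apply: cmax; apply/asboolP; exists w.
apply: hw; exists w1; rewrite -cntE w1c -lee_fin.
have : (\int[P]_w (\sum_(i <- [seq i <- index_enum I | Q i]) (\1_(A i) w)%:E)%E <=
    \int[P]_w (cst c%:R%:E w))%E.
  apply: ge0_le_integral => //.
  - by move=> w _; apply: sume_ge0 => i _; rewrite lee_fin.
  - apply: emeasurable_sum => i; apply/measurable_EFinP.
    exact: measurable_indic.
  - move=> w _; rewrite big_filter sumEFin lee_fin.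
    under eq_bigr do rewrite indicE.
    by rewrite -cntE ler_nat.
rewrite integral_cst// [X in (_ * X)%E](_ : _ = 1%E); last exact: probability_setT.
rewrite mule1 ge0_integral_sum//; last first.
  by move=> i; apply/measurable_EFinP; exact: measurable_indic.
apply: le_trans; rewrite big_filter.
under eq_bigr do rewrite integral_indic// setIT.
apply: (@le_trans _ _ (\sum_(i | Q i) p%:E)%E); last exact: lee_sum.
by rewrite sumEFin sumr_const mulr_natr.
Qed.

End Derandomization.

Section Measurability.
Context (R : realType) (n b : nat) (d : measure_display) (Om : measurableType d)
  (alg : streaming_algorithm R n b Om).

Lemma measurable_run_from (s : stream R n) t m m' :
  measurable [set w | run_from alg w t m s = m'].
Proof.
elim: s t m m' => [|u s IH] t m m' /=.
  by have [->|mm] := eqVneq m m'; [rewrite (_ : mkset _ = setT) ?eqEsubset//|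
    rewrite (_ : mkset _ = set0)// -subset0 => w /= /eqP; rewrite (negbTE mm)].
rewrite (_ : mkset _ = \bigcup_(m'' in [set: b.-tuple bool])
    ([set w | alg_step alg w t m u = m''] `&`
     [set w | run_from alg w t.+1 m'' s = m'])).
  apply: fin_bigcup_measurable; first exact: finite_finset.
  by move=> m'' _; apply: measurableI; [exact: measurable_alg_step|exact: IH].
apply/seteqP; split => [w /= ws|w /= [m'' _ [/= -> //]]].
by exists (alg_step alg w t m u).
Qed.

Lemma measurable_run_approximates (s : stream R n) eps Q :
  measurable [set w | approximates eps Q (run alg w s)].
Proof.
pose M0 := \bigcup_(m0 in [set: b.-tuple bool]) \bigcup_(m in [set: b.-tuple bool])
  ([set w | alg_init alg w = m0] `&` [set w | run_from alg w 0 m0 s = m] `&`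
   [set w | approximates eps Q (alg_output alg w m)]).
rewrite (_ : mkset _ = M0).
  apply: fin_bigcup_measurable => [|m0 _]; first exact: finite_finset.
  apply: fin_bigcup_measurable => [|m _]; first exact: finite_finset.
  apply: measurableI; first apply: measurableI.
  - exact: measurable_alg_init.
  - exact: measurable_run_from.
  rewrite -[mkset _]setTI; apply: measurable_fun_le => //.
  apply: measurableT_comp; first exact: normr_measurable.
  by apply: measurable_funB => //; exact: measurable_alg_output.
apply/seteqP; split => [w /= ws|w /= [m0 _ [m _ [[/= i0 rm] out]]]]; last by rewrite /run i0 rm.
by exists (alg_init alg w) => //; exists (run_from alg w 0 (alg_init alg w) s).
Qed.

Lemma run_from_cat w t m (s s' : stream R n) :
  run_from alg w t m (s ++ s') =
  run_from alg w (t + size s) (run_from alg w t m s) s'.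
Proof.
elim: s t m => [|u s IH] t m /=; first by rewrite addn0.
by rewrite IH addnS addSn.
Qed.

End Measurability.

Lemma parity_compl h (y : 'I_h.*2 -> bool) :
  \big[addb/false]_j ~~ y j = \big[addb/false]_j y j.
Proof.
under eq_bigr do rewrite -addTb.
rewrite big_split/= big_const_ord.
suff -> : iter h.*2 (addb true) false = false by rewrite addFb.
by elim: h {y} => //= h ->.
Qed.

Section HardInstance.
Context (R : realType) (n N m h : nat).
Let t := h.*2.
Let pattern := {ffun 'I_t -> bool}.
Let column := ('I_N * bool * pattern)%type.
Let block := ('I_m * pattern)%type.
Context (iota : column + block -> 'I_n).
Hypothesis iota_inj : injective iota.
Hypothesis h0 : (0 < h)%N.

Definition vertex_bit (x : {ffun 'I_N -> bool}) (c : column) : bool :=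
  x c.1.1 (+) c.1.2.

Definition block_column (M : {ffun 'I_m -> {ffun 'I_t -> 'I_N}})
    (q : block) (j : 'I_t) : column := (M q.1 j, q.2 j, q.2).

Definition active_block (M : {ffun 'I_m -> {ffun 'I_t -> 'I_N}})
    (w : {ffun 'I_m -> bool}) : pred block :=
  fun q => isolated_edge M q.1 && (\big[addb/false]_j q.2 j == w q.1).

Definition alice_stream x : stream R n := diag_stream R iota (vertex_bit x).

Definition bob_stream M w : stream R n :=
  link_stream R iota (active_block M w) (block_column M).

Lemma block_column_inj M w q q' j j' :
  active_block M w q -> active_block M w q' ->
  block_column M q j = block_column M q' j' -> (q, j) = (q', j').
Proof.
case: q q' => [a u] [a' u'] /andP[/forallP/(_ j) isoa _] _ [/= Mj _ uu].
move: isoa => /forallP/(_ a')/forallP/(_ j'); rewrite Mj eqxx/= => /eqP[-> ->].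
by rewrite uu.
Qed.

Lemma size_hard_stream x M w :
  (size (alice_stream x ++ bob_stream M w) <= (t.+1) * (#|{: column}| + #|{: block}|))%N.
Proof.
rewrite size_cat !size_map -enumT -!cardE.
have : (#|[pred q : block * 'I_t | active_block M w q.1]| <= #|{: block}| * t)%N.
  by rewrite -[t in (_ * t)%N]card_ord -card_prod max_card.
rewrite -(leq_add2l #|{: column}|) => /leq_trans; apply.
rewrite mulSn -addnA leq_add2l mulnDr (mulnC _ t).
by apply: leq_trans (leq_addl _ _); exact: leq_addl.
Qed.

Let lamA : R := t%:R + 1.
Let lamB : R := t%:R + 1 - (t%:R + 1)^-1.

Lemma top_sum_even (f : R -> R) k x M :
  (0 < k)%N -> (k <= #|[pred a | isolated_edge M a]|)%N ->
  top_sum f k (stream_mx (alice_stream x ++ bob_stream M (parities M x))) =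
  k%:R * f (Num.sqrt lamA).
Proof.
move=> k0 kiso.
have t0 : (0 < t)%N by rewrite double_gt0.
have t1 : 1 <= t%:R :> R by rewrite ler1n.
have inj := @block_column_inj M (parities M x).
apply: top_sum_eq_max.
  move=> s hs; suff /andP[] : 0 <= s <= Num.sqrt lamA by [].
  move: s hs; apply: (singular_values_block_le iota_inj inj).
  - by rewrite /lamA; lra.
  - by move=> c; rewrite /lamA; case: vertex_bit => /=; lra.
  - move=> b _; apply: (@le_trans _ _ (\sum_(j < t) t%:R^-1)).
      apply: ler_sum => j _.
      have le : t%:R <= lamA - (vertex_bit x (block_column M b j))%:R.
        by rewrite /lamA; case: vertex_bit => /=; lra.
      by rewrite lef_pV2 ?posrE//; lra.
    by rewrite sumr_const card_ord -(mulr_natl (t%:R^-1)) divff// gt_eqF//; lra.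
apply: (leq_trans kiso); set k' := #|_|.
pose b (i : 'I_k') : block :=
  let a := enum_val i in (a, [ffun j => ~~ x (M a j)]).
have b_inj : injective b by move=> i i' /(congr1 fst)/= /enum_val_inj.
have ab i : active_block M (parities M x) (b i).
  rewrite /active_block /=; apply/andP; split; first by have := enum_valP i; rewrite inE.
  rewrite ffunE /edge_parity; apply/eqP.
  by under eq_bigr do rewrite ffunE; exact: parity_compl.
apply: (count_singular_values_ge (leq_trans k0 kiso)
  (row_free_block_vectors _ iota_inj inj b_inj ab t0)).
apply/row_matrixP => i; rewrite row_mul linearZ/= !rowK.
apply: mul_block_vector => // j.
by rewrite /vertex_bit /= ffunE addbN addbb.
Qed.

Lemma singular_values_odd x M s :
  s \in singular_values
    (stream_mx (alice_stream x ++ bob_stream M (shift_parities true (parities M x)))) ->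
  0 <= s <= Num.sqrt lamB.
Proof.
have t0 : (0 < t)%N by rewrite double_gt0.
have t1 : 1 <= t%:R :> R by rewrite ler1n.
have inj := @block_column_inj M (shift_parities true (parities M x)).
have iV : (t%:R + 1)^-1 <= 2^-1 :> R by rewrite lef_pV2 ?posrE; lra.
have iV0 : 0 < (t%:R + 1)^-1 :> R by rewrite invr_gt0; lra.
apply: (singular_values_block_le iota_inj inj).
- by rewrite /lamB; lra.
- by move=> c; rewrite /lamB; case: vertex_bit => /=; lra.
move=> [a u] /andP[_ /= /eqP par_u].
have [j0 dj0] : exists j, ~~ vertex_bit x (block_column M (a, u) j).
  apply/existsP; rewrite -negb_forall; apply/negP => /forallP all1.
  move: par_u; rewrite !ffunE /edge_parity -parity_compl.
  under eq_bigr => j _.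
    have -> : ~~ u j = x (M a j).
      by have := all1 j; rewrite /vertex_bit /=; case: (x _); case: (u j).
    over.
  by case: (\big[addb/false]_j _).
rewrite (bigD1 j0)//= (negbTE dj0) subr0.
have d1 : lamB - 1 = (t%:R ^+ 2 + t%:R - 1) / (t%:R + 1).
  by rewrite /lamB; field; rewrite gt_eqF//; lra.
have q0 : 0 < t%:R ^+ 2 + t%:R - 1 :> R by nra.
have lB1 : 0 < lamB - 1 by rewrite d1 divr_gt0//; lra.
apply: (@le_trans _ _ (lamB^-1 + \sum_(j < t | j != j0) (lamB - 1)^-1)).
  rewrite lerD2l; apply: ler_sum => j _.
  have le : lamB - 1 <= lamB - (vertex_bit x (block_column M (a, u) j))%:R.
    by rewrite lerD2l lerN2; case: vertex_bit.
  by rewrite lef_pV2 ?posrE//; lra.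
rewrite sumr_const cardC1 card_ord -(mulr_natl (lamB - 1)^-1) -subn1 natrB//.
have -> : lamB^-1 = (t%:R + 1) / (t%:R * (t%:R + 2)).
  have p1 : 0 < (t%:R + 1) * (t%:R + 1) - 1 :> R by nra.
  by rewrite /lamB; field; apply/and4P; split; rewrite gt_eqF//; lra.
have -> : (t%:R - 1) * (lamB - 1)^-1 = (t%:R ^+ 2 - 1) / (t%:R ^+ 2 + t%:R - 1) :> R.
  by rewrite d1; field; rewrite !gt_eqF//; lra.
rewrite -subr_ge0.
have -> : 1 - ((t%:R + 1) / (t%:R * (t%:R + 2)) +
    (t%:R ^+ 2 - 1) / (t%:R ^+ 2 + t%:R - 1)) =
    (t%:R * (t%:R + 2) * (t%:R ^+ 2 + t%:R - 1))^-1 :> R.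
  by field; rewrite !gt_eqF//; lra.
by rewrite invr_ge0 mulr_ge0 ?mulr_ge0//; lra.
Qed.

End HardInstance.

Lemma streaming_success_bound (R : realType) (n N m h k b K : nat)
    (d : measure_display) (Om : measurableType d) (P : probability Om R)
    (alg : streaming_algorithm R n b Om) (D : set (stream R n))
    (f : R -> R) (eps p r dl th : R)
    (sA := Num.sqrt (h.*2%:R + 1 : R))
    (sB := Num.sqrt (h.*2%:R + 1 - (h.*2%:R + 1)^-1 : R)) :
  (0 < N)%N -> (0 < h)%N -> (32 * m <= N)%N -> (4 * m * h.*2 ^ 2 <= N)%N ->
  (N * 2 * 2 ^ h.*2 + m * 2 ^ h.*2 <= n)%N -> (h.*2 < K)%N ->
  (0 < k)%N -> (2 * k <= m)%N ->
  f 0 = 0 -> (forall x y, 0 <= x <= y -> `|f x| <= `|f y|) ->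
  0 <= eps -> (1 + eps) * `|f sB| < (1 - eps) * `|f sA| ->
  [set s | sparse_stream K s] `<=` D ->
  approximates_top_sum P alg D f k eps p ->
  0 <= dl -> (1 + r ^+ h) ^+ m <= 1 + dl -> 0 < th ->
  2 * p <= 1 + th / 2 + (dl + 2 * 2 ^+ b * expR (- (N%:R * r / 32))) / th.
Proof.
move=> N0 h0 mN tN sizen hK k0 km f0 fm eps0 gap sparseD algP dl0 hr th0.
pose t := h.*2.
pose pattern := {ffun 'I_t -> bool}.
pose column := ('I_N * bool * pattern)%type.
pose block := ('I_m * pattern)%type.
have cardCB : (#|{: column}| + #|{: block}| <= n)%N.
  by rewrite !card_prod !card_ffun !card_ord card_bool.
have le_n : (#|{: column + block}| <= n)%N by rewrite card_sum.
pose iota (s : column + block) : 'I_n := widen_ord le_n (enum_rank s).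
have iota_inj : injective iota.
  by move=> s s' /(congr1 val)/= /val_inj/enum_rank_inj.
pose hyper := {ffun 'I_m -> {ffun 'I_t -> 'I_N}}.
pose bits := {ffun 'I_N -> bool}.
pose G : pred hyper := fun M => well_spread M.
pose w_of (i : hyper * bits * bool) := shift_parities i.2 (parities i.1.1 i.1.2).
pose str (i : hyper * bits * bool) : stream R n :=
  alice_stream R iota i.1.2 ++ bob_stream R iota i.1.1 (w_of i).
pose Q (i : hyper * bits * bool) := G i.1.1.
pose A i := [set w | approximates eps (top_sum f k (stream_mx (str i))) (run alg w (str i))].
have sparse i : sparse_stream K (str i).
  have sz : (size (str i) <= K * n)%N.
    by apply: (leq_trans (size_hard_stream _ iota _ _ _)); exact: leq_mul.
  split => //; last exact: leq_trans (nnz_stream_mx _) sz.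
  have K1 : 1 <= K%:R :> R by rewrite ler1n (leq_trans _ hK).
  move=> u; rewrite mem_cat => /orP[] /mapP[q _ ->] /=.
    by rewrite natr_int normr_nat; split=> //; case: vertex_bit => //=; rewrite (le_trans _ K1).
  by rewrite normr1; split => //; exact: rpred1.
have [w0 hw0] := @exists_good_seed _ _ _ P _ Q A p
  (fun i => measurable_run_approximates alg (str i) eps _)
  (fun i _ => algP _ (sparseD _ (sparse i))).
pose thr := (1 + eps) * (k%:R * `|f sB|).
pose msg (x : bits) := run_from alg w0 0 (alg_init alg w0) (alice_stream R iota x).
pose dec (tau : b.-tuple bool) (M : hyper) (w : {ffun 'I_m -> bool}) : bool :=
  `|alg_output alg w0 (run_from alg w0 (size (enum {: column})) tau
      (bob_stream R iota M w))| <= thr.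
have runE i : run alg w0 (str i) = alg_output alg w0
    (run_from alg w0 (size (enum {: column})) (msg i.1.2) (bob_stream R iota i.1.1 (w_of i))).
  by rewrite /run run_from_cat add0n size_map.
have kpos : 0 < k%:R :> R by rewrite ltr0n.
have decP i : Q i -> w0 \in A i -> dec (msg i.1.2) i.1.1 (w_of i) == i.2.
  move=> Qi /set_mem; rewrite /A /= /approximates runE /dec.
  move: (alg_output _ _ _) => out; case: i Qi => -[M x] [] /= Qi.
    have := norm_top_sum_le k (sqrtr_ge0 _) f0 fm
      (fun s hs => singular_values_odd iota_inj h0 hs).
    move=> /(_ x M); rewrite -/sB; set T := top_sum _ _ _ => hT ho.
    rewrite eqb_id /thr.
    have : `|out| <= `|T| + `|out - T| by rewrite -[in leLHS](subrK T out) addrC ler_normD.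
    have : (1 + eps) * `|T| <= (1 + eps) * (k%:R * `|f sB|).
      by rewrite ler_wpM2l//; lra.
    lra.
  rewrite /str /w_of /= shift_parities_false.
  rewrite (top_sum_even iota_inj h0)//; last first.
    move: Qi; rewrite /Q/= /G /well_spread => mk.
    by rewrite -(leq_pmul2l (isT : 0 < 2)%N) (leq_trans km).
  rewrite -/sA; set T := k%:R * f sA => ho.
  rewrite eqbF_neg -ltNge /thr.
  have : `|T| <= `|out| + `|out - T|.
    by rewrite -[in leLHS](subKr out T) ler_normB.
  have -> : `|T| = k%:R * `|f sA| by rewrite normrM ger0_norm// ltW.
  move: ho; rewrite normrM (ger0_norm (ltW kpos)).
  by move: gap; rewrite -(ltr_pM2l kpos); lra.
have sumle : p * #|Q|%:R <= \sum_(M | G M) \sum_x \sum_c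
    (dec (msg x) M (shift_parities c (parities M x)) == c)%:R.
  apply: (le_trans hw0).
  apply: (@le_trans _ _ (\sum_(i | Q i) (dec (msg i.1.2) i.1.1 (w_of i) == i.2)%:R)).
    apply: ler_sum => i Qi; rewrite ler_nat.
    by have := decP i Qi; case: (_ \in _) => // ->.
  rewrite le_eqVlt; apply/predU1P; left.
  rewrite pair_big_dep/= pair_big_dep/=.
  apply: eq_big => [[[M x] c]|[[M x] c] _] //=.
  by rewrite /Q /= !andbT.
have Gcard : #|Q|%:R = #|G|%:R * 2 ^+ N * 2 :> R.
  rewrite -[in RHS]natrX -!natrM -sum1_card; congr (_%:R).
  transitivity (\sum_(M | G M) \sum_(x : bits) \sum_(c : bool) 1)%N.
    rewrite pair_big_dep/= pair_big_dep/=.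
    by apply: eq_bigl => -[[M x] c]; rewrite /= !andbT.
  rewrite !sum_nat_const muln1 card_bool card_ffun card_bool card_ord.
  by rewrite mulnA.
have := le_trans sumle (one_way_success_le msg dec G N0 h0 mN dl0 hr th0).
rewrite Gcard card_tuple card_bool natrX.
have GM : (N%:R ^+ t) ^+ m <= 2 * #|G|%:R :> R.
  rewrite -!natrX -natrM ler_nat.
  by have := card_well_spread tN; rewrite !card_ffun !card_ord double_gt0; apply.
set e := expR _; set g : R := #|G|%:R in GM *.
set mu : R := (_ ^+ t) ^+ m in GM *.
have mu0 : 0 < mu by rewrite !exprn_gt0// ltr0n.
have g0 : 0 < g by lra.
set V := dl + _.
have V0 : 0 <= V.
  by rewrite /V addr_ge0// mulr_ge0 ?expR_ge0// mulr_ge0// exprn_ge0.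
move=> hp.
have {}hp : 2 ^+ N * (g * (2 * p)) <= 2 ^+ N * (g * (1 + th / 2 + V / th)).
  apply: le_trans (_ : 2 ^+ N * (g * (1 + th / 2) + mu / (2 * th) * V) <= _).
    by apply: le_trans hp; rewrite le_eqVlt; apply/predU1P; left; ring.
  rewrite ler_pM2l ?exprn_gt0// [leRHS]mulrDr lerD2l.
  rewrite mulrA [leRHS]mulrAC -[leRHS]/(g / th * V) ler_wpM2r//.
  by rewrite ler_pdivrMr ?mulr_gt0// mulrCA divfK ?gt_eqF// mulrC.
by move: hp; rewrite ler_pM2l ?exprn_gt0// ler_pM2l.
Qed.

Lemma strictly_monotone_norm (R : realType) (f : R -> R) x y :
  strictly_monotone_nonneg f -> f 0 = 0 -> 0 <= x -> x < y -> `|f x| < `|f y|.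
Proof.
move=> fm f0 x0 xy; have y0 : 0 < y by exact: le_lt_trans xy.
have [->|xn0] := eqVneq x 0.
  rewrite f0 normr0 normr_gt0; apply/eqP => fy.
  by case: fm => /(_ 0 y (lexx _) y0); rewrite f0 fy ltxx.
have {xn0}xpos : 0 < x by rewrite lt_def xn0.
case: fm => fm; have := fm 0 x (lexx _) xpos; have := fm x y x0 xy; rewrite f0 => h1 h2.
  by rewrite !gtr0_norm//; apply: lt_trans h1.
by rewrite !ltr0_norm ?ltrN2//; apply: lt_trans h1 _.
Qed.

Lemma memory_gt0 (R : realType) (n k b : nat) (d : measure_display)
    (Om : measurableType d) (P : probability Om R)
    (alg : streaming_algorithm R n b Om) (D : set (stream R n)) (f : R -> R) p :
  strictly_monotone_nonneg f -> f 0 = 0 -> (0 < k <= n)%N ->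
  [set s | sparse_stream 1 s] `<=` D -> 2^-1 < p ->
  approximates_top_sum P alg D f k 2^-1 p -> (0 < b)%N.
Proof.
move=> fm f0 /andP[k0 kn] sD p2 hP; rewrite lt0n; apply/eqP => b0; subst b.
have two_good (x y : bool) : p * 2 <= x%:R + y%:R -> x && y.
  by clear -p2; case: x; case: y => //=; lra.
have fle x y : 0 <= x <= y -> `|f x| <= `|f y|.
  rewrite [x <= y]le_eqVlt => /andP[x0 /predU1P[->//|xy]].
  exact/ltW/strictly_monotone_norm.
pose str (i : bool) : stream R n := if i then [seq ((j, j), 1) | j <- enum 'I_n] else [::].
have mx1 : stream_mx (str true) = 1%:M.
  apply/matrixP => i l; rewrite stream_mxE big_map big_enum/= mxE.
  rewrite (bigD1 i)//= eqxx mul1r big1 ?addr0 1?eq_sym// => j.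
  by rewrite eq_sym => /negbTE ->; rewrite mulr0.
have mx0 : stream_mx (str false) = 0 by rewrite /stream_mx big_nil.
have sparse i : sparse_stream 1 (str i).
  have sz : (size (str i) <= 1 * n)%N.
    by case: i => //; rewrite mul1n size_map -cardE card_ord.
  split => //; last exact: leq_trans (nnz_stream_mx _) sz.
  case: i {sz} => // u /mapP[j _ ->] /=.
  by rewrite normr1; split => //; exact: rpred1.
pose A i := [set w | approximates 2^-1 (top_sum f k (stream_mx (str i))) (run alg w (str i))].
have [w] := @exists_good_seed _ _ _ P _ xpredT A p
  (fun i => measurable_run_approximates alg (str i) _ _)
  (fun i _ => hP _ (sD _ (sparse i))).
rewrite card_bool big_bool => hw.
have /andP[memT memF] := two_good _ _ hw.
have runE : run alg w (str true) = run alg w (str false).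
  have all0 (m m' : 0.-tuple bool) : m = m' by rewrite (tuple0 m) (tuple0 m').
  exact: congr1 (all0 _ _).
have q0 : top_sum f k (stream_mx (str false)) = 0.
  apply/normr0_eq0/eqP; rewrite eq_le normr_ge0 andbT.
  have := @norm_top_sum_le _ _ (stream_mx (str false)) f k 0 (lexx _) f0 fle.
  rewrite f0 normr0 mulr0; apply=> s; rewrite -[X in _ -> _ <= _ <= X]sqrtr0.
  apply: mem_singular_values_le => u; rewrite mul0r mx0 trmx0 mulmx0.
  by rewrite big1// => i _; rewrite mxE expr0n.
have q1 : top_sum f k (stream_mx (str true)) = k%:R * f 1.
  rewrite mx1 -[X in f X]sqrtr1; apply: top_sum_eq_max.
    move=> s hs; suff /andP[] : 0 <= s <= Num.sqrt 1 by [].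
    move: s hs; apply: mem_singular_values_le => u.
    by rewrite mul1r trmx1 mulmx1.
  apply: (leq_trans kn); apply: (@count_singular_values_ge _ _ _ _ 1%:M).
  - exact: leq_trans kn.
  - by rewrite row_free_unit unitmx1.
  - by rewrite trmx1 !mulmx1 scale1r.
have := set_mem memT; have := set_mem memF.
rewrite /A /= /approximates runE q0 q1 normr0 mulr0 subr0.
move=> /(le_trans _)-/(_ _ (lexx _)); rewrite normr_le0 => /eqP ->.
rewrite sub0r normrN normrM ger0_norm ?ler0n//.
have := strictly_monotone_norm fm f0 (lexx _) ltr01; rewrite f0 normr0.
by move=> f1 hk; have : 0 < k%:R * `|f 1| by [rewrite mulr_gt0// ltr0n]; lra.
Qed.

(* [(N * 2 * 2^t + m * 2^t) / m], where [t = 2 h] and [N = 4 m t^2]. *)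
Definition edge_size h : nat := ((8 * h.*2 ^ 2).+1 * 2 ^ h.*2)%N.

Lemma edge_size_le h : (0 < h)%N -> (4 * edge_size h <= 2 ^ (40 * h))%N.
Proof.
move=> h0; have hh : (h <= 2 ^ h)%N by rewrite ltnW// ltn_expl.
have h2 : (h ^ 2 <= 2 ^ h.*2)%N by rewrite -mul2n mulnC expnM leq_sqr.
have p1 : (0 < 2 ^ h.*2)%N by rewrite expn_gt0.
have b1 : ((8 * h.*2 ^ 2).+1 <= 33 * 2 ^ h.*2)%N.
  by rewrite -mul2n expnMn mul2n; lia.
have b2 : (4 * edge_size h <= 2 ^ 8 * (2 ^ h.*2 * 2 ^ h.*2))%N.
  have := leq_mul b1 (leqnn (2 ^ h.*2)); rewrite /edge_size.
  have : (0 < 2 ^ h.*2 * 2 ^ h.*2)%N by rewrite muln_gt0 p1.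
  by lia.
apply: leq_trans b2 _; rewrite -!expnD leq_exp2l//.
by lia.
Qed.

Lemma edge_size_expR (R : realType) (h : nat) (L : R) :
  (0 < h)%N -> 40 * h%:R <= L -> 4 * (edge_size h)%:R * expR (- L) <= 1.
Proof.
move=> h0 hL; rewrite expRN ler_pdivrMr ?expR_gt0// mul1r.
apply: (@le_trans _ _ (2 ^+ (40 * h))).
  by rewrite -natrX -natrM ler_nat edge_size_le.
apply: (@le_trans _ _ (expR 1 ^+ (40 * h))).
  rewrite lerXn2r ?nnegrE ?expR_ge0//.
  by apply: le_trans (expR_ge1Dx _); rewrite -natr1.
by rewrite -expRM_natl mulr1 ler_expR natrM.
Qed.

Lemma excess_budget (R : realType) (n m h : nat) (ka : R) :
  (0 < n)%N -> (0 < h)%N -> (m <= n)%N -> 0 <= ka <= 2^-1 ->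
  (1 + (ka * n%:R `^ (- h%:R^-1)) ^+ h) ^+ m <= 1 + 2 * ka.
Proof.
move=> n0 h0 mn /andP[ka0 ka1].
have nR : 0 < n%:R :> R by rewrite ltr0n.
have -> : (ka * n%:R `^ (- h%:R^-1)) ^+ h = ka ^+ h / n%:R.
  rewrite exprMn -[_ `^ _ ^+ h]powR_mulrn ?powR_ge0// -powRrM mulNr mulVf; last first.
    by rewrite pnatr_eq0 -lt0n.
  by rewrite powR_inv1// ltW.
have kh : ka ^+ h <= ka.
  by case: h h0 => // h _; rewrite exprS ler_piMr// exprn_ile1//; lra.
apply: (@le_trans _ _ (expR (m%:R * (ka ^+ h / n%:R)))).
  rewrite expRM_natl lerXn2r ?nnegrE ?expR_ge0 ?expR_ge1Dx//.
  by rewrite addr_ge0// divr_ge0 ?exprn_ge0.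
apply: (@le_trans _ _ (expR ka)).
  rewrite ler_expR mulrA ler_pdivrMr//.
  have : m%:R * ka ^+ h <= m%:R * ka by rewrite ler_wpM2l.
  have : m%:R * ka <= n%:R * ka by rewrite ler_wpM2r// ler_nat.
  lra.
rewrite -[ka in expR ka]opprK expRN invf_ple ?posrE ?expR_gt0//; last by lra.
apply: le_trans (expR_ge1Dx _).
rewrite -[leLHS]mul1r ler_pdivrMr; last by lra.
by nra.
Qed.

Definition space_lower_bound (R : realType) (alpha p e : R) : Prop :=
  exists (K : nat) (C : R), 0 < C /\
    forall f : R -> R, strictly_monotone_nonneg f -> f 0 = 0 ->
    exists eps : R, 0 < eps /\
    exists n0 : nat, forall n : nat, (n0 <= n)%N ->
    forall k : nat, (0 < k)%N -> k%:R <= alpha * n%:R ->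
    forall D : set (stream R n), [set s | sparse_stream K s] `<=` D ->
    forall (d : measure_display) (Om : measurableType d) (P : probability Om R)
      (b : nat) (alg : streaming_algorithm R n b Om),
    approximates_top_sum P alg D f k eps p ->
    C * (n%:R `^ e) <= b%:R.

Lemma space_lower_bound_le0 (R : realType) (alpha p e : R) :
  0 < alpha -> alpha < 2^-1 -> 2^-1 < p -> e <= 0 -> space_lower_bound alpha p e.
Proof.
move=> a0 a1 p2 e0; exists 1%N, 1; split => // f fm f0; exists 2^-1; split => //.
exists 1%N => n n1 k k0 kn D sD d Om P b alg hP.
have kn' : (0 < k <= n)%N.
  rewrite k0 -(ler_nat R) (le_trans kn)// ler_piMl//; lra.
have b1 : 1 <= b%:R :> R by rewrite ler1n (memory_gt0 fm f0 kn' sD p2 hP).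
rewrite mul1r; apply: le_trans b1; rewrite -[leRHS](powRr0 n%:R).
by apply: ler_powR; first by rewrite ler1n.
Qed.

(* With [t = 2 h] the hard instance gives the exponent [1 - 2 / t], and
   [L / 80 < h <= L / 40]. *)
Lemma space_lower_bound_small (R : realType) (alpha p e : R) :
  0 < alpha -> alpha < 2^-1 -> 2^-1 < p -> p <= 1 ->
  80 <= - ln alpha -> e <= 1 - 80 / - ln alpha -> space_lower_bound alpha p e.
Proof.
move=> a0 a1 p2 p1; set L := - ln alpha => L80 expo0.
pose h := Num.truncn (L / 40).
have /andP[hL Lh] : h%:R <= L / 40 < h.+1%:R by apply: truncn_itv; lra.
have h2 : (2 <= h)%N by rewrite truncn_ge_nat; lra.
have h0 : (0 < h)%N by exact: leq_trans h2.
have h2R : 2 <= h%:R :> R by rewrite ler_nat.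
have hR : 0 < h%:R :> R by lra.
have invh : h%:R^-1 <= 2^-1 :> R by rewrite lef_pV2 ?posrE.
have expo : e <= 1 - h%:R^-1.
  apply: (le_trans expo0); rewrite lerD2l lerN2 ler_pdivlMr; last by lra.
  rewrite mulrC ler_pdivrMr//; move: Lh; rewrite -(natr1 h); lra.
pose De := edge_size h.
have De0 : (0 < De)%N by rewrite muln_gt0 expn_gt0.
have DeR : 1 <= De%:R :> R by rewrite ler1n.
have alphaDe : 4 * De%:R * alpha <= 1.
  have -> : alpha = expR (- L) by rewrite /L opprK lnK.
  by apply: edge_size_expR => //; lra.
pose g := 2 * p - 1; have g0 : 0 < g by rewrite /g; lra.
have g1 : g <= 1 by rewrite /g; lra.
pose ka := g ^+ 2 / 16.
have ka0 : 0 < ka by rewrite divr_gt0 ?exprn_gt0.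
have ka1 : ka <= 2^-1 by rewrite /ka; nra.
pose C := ka / (2 * De%:R).
have C0 : 0 < C by rewrite divr_gt0//; lra.
exists h.*2.+1, C; split => // f fm f0.
pose sA := Num.sqrt (h.*2%:R + 1 : R).
pose sB := Num.sqrt (h.*2%:R + 1 - (h.*2%:R + 1)^-1 : R).
have t0 : 0 < h.*2%:R :> R by rewrite ltr0n double_gt0.
have sAB : sB < sA by rewrite ltr_sqrt ?gtrBl ?invr_gt0; lra.
have fAB := strictly_monotone_norm fm f0 (sqrtr_ge0 _) sAB.
have fB := normr_ge0 (f sB).
pose eps := (`|f sA| - `|f sB|) / (2 * (`|f sA| + `|f sB|)).
have eps0 : 0 < eps by rewrite divr_gt0//; lra.
have gap : (1 + eps) * `|f sB| < (1 - eps) * `|f sA|.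
  have : eps * (`|f sA| + `|f sB|) = (`|f sA| - `|f sB|) / 2.
    by rewrite /eps; field; rewrite gt_eqF//; lra.
  by lra.
have fle x y : 0 <= x <= y -> `|f x| <= `|f y|.
  rewrite [x <= y]le_eqVlt => /andP[x0 /predU1P[->//|xy]].
  exact/ltW/strictly_monotone_norm.
exists eps; split => //.
pose X := 2 / (2 * ka * C).
have X0 : 0 < X by apply: divr_gt0 => //; apply: mulr_gt0 => //; lra.
exists (maxn De (Num.truncn (X ^+ 2)).+1) => n.
rewrite geq_max => /andP[nDe nX] k k0 kn D sD d Om P b alg hP.
have n0 : (0 < n)%N by exact: leq_trans nDe.
have nR : 1 <= n%:R :> R by rewrite ler1n.
pose m := (n %/ De)%N.
have m0 : (0 < m)%N by rewrite divn_gt0.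
have mD : (m * De <= n)%N by exact: leq_divM.
have nm : (n <= 2 * (m * De))%N.
  have : (n < m.+1 * De)%N by exact: ltn_ceil.
  rewrite mulSn mul2n -addnn => /ltnW/leq_trans; apply.
  by rewrite leq_add2r leq_pmull.
have nmR : n%:R <= 2 * (m%:R * De%:R) :> R by rewrite -!natrM ler_nat.
have mn : (m <= n)%N by apply: leq_trans mD; rewrite leq_pmulr.
have km : (2 * k <= m)%N.
  rewrite -(ler_nat R) natrM.
  have mR : 0 <= m%:R :> R by [].
  have : alpha * n%:R <= alpha * (2 * (m%:R * De%:R)) by rewrite ler_pM2l.
  have : 4 * De%:R * alpha * m%:R <= 1 * m%:R by rewrite ler_wpM2r.
  lra.
pose N := (4 * m * h.*2 ^ 2)%N.
have N4 : (64 * m <= N)%N.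
  have -> : N = (16 * m * h ^ 2)%N by rewrite /N -mul2n expnMn; ring.
  rewrite (_ : 64 * m = 16 * m * 2 ^ 2)%N; last by ring.
  by rewrite leq_mul2l leq_sqr h2 orbT.
rewrite leNgt; apply/negP => hb.
pose B : R := n%:R `^ (1 - h%:R^-1).
have B1 : X <= B.
  apply: (@le_trans _ _ (n%:R `^ 2^-1)); last by apply: ler_powR => //; lra.
  rewrite powR12_sqrt// [leLHS](_ : X = Num.sqrt (X ^+ 2)); last first.
    by rewrite sqrtr_sqr gtr0_norm.
  apply/ler_wsqrtr/ltW; rewrite (lt_le_trans (truncnS_gt _))// ler_nat.
  exact: nX.
have bB : b%:R < C * B.
  by apply: lt_le_trans hb _; rewrite ler_pM2l//; exact: ler_powR.
pose r := ka * n%:R `^ (- h%:R^-1).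
have Nr : 2 * (C * B) <= N%:R * r / 32.
  have BE : B = n%:R * n%:R `^ (- h%:R^-1).
    by rewrite /B powRD ?powRr1 ?ler0n// pnatr_eq0 -lt0n n0 implybT.
  set y := n%:R `^ _ in BE; have y0 : 0 < y by apply: powR_gt0; lra.
  have -> : 2 * (C * B) = ka * y * (n%:R / De%:R).
    by rewrite /C BE; field; rewrite gt_eqF//; lra.
  have -> : N%:R * r / 32 = ka * y * (N%:R / 32) by rewrite /r -/y; ring.
  rewrite ler_pM2l; last exact: mulr_gt0.
  rewrite ler_pdivrMr; last by lra.
  have : 64 * m%:R <= N%:R :> R by rewrite -natrM ler_nat.
  by move=> h64; apply: le_trans nmR _; rewrite mulrA ler_wpM2r//; lra.
have tail : 2 * 2 ^+ b * expR (- (N%:R * r / 32)) <= 2 * ka.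
  have two_e : 2 ^+ b <= expR (C * B).
    apply: (@le_trans _ _ (expR 1 ^+ b)).
      rewrite lerXn2r ?nnegrE ?expR_ge0//.
      by apply: le_trans (expR_ge1Dx _); rewrite -natr1.
    by rewrite -expRM_natl mulr1 ler_expR ltW.
  apply: (@le_trans _ _ (2 * expR (C * B) * expR (- (2 * (C * B))))).
    by apply: ler_pM; rewrite ?mulr_ge0 ?exprn_ge0 ?expR_ge0 ?ler_pM2l ?ler_expR ?lerN2.
  rewrite -mulrA -expRD -[C * B - _](_ : - (C * B) = _); last by ring.
  rewrite expRN ler_pdivrMr ?expR_gt0//.
  have kC0 : 0 < 2 * ka * C by apply: mulr_gt0 => //; lra.
  apply: (@le_trans _ _ (B * (2 * ka * C))).
    by rewrite -ler_pdivrMr.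
  rewrite [leLHS](_ : _ = 2 * ka * (C * B)); last by ring.
  rewrite ler_pM2l; last by lra.
  by apply: le_trans (expR_ge1Dx _); rewrite lerDr.
have := @streaming_success_bound R n N m h k b h.*2.+1 d Om P alg D f eps p r (2 * ka) g.
move=> /(_ _ h0 _ (leqnn _) _ (ltnSn _) k0 km f0 fle (ltW eps0) gap sD hP _ _ g0).
have step1 : (0 < N)%N by apply: leq_trans N4; rewrite muln_gt0.
have step2 : (32 * m <= N)%N by apply: leq_trans N4; rewrite leq_mul2r orbT.
have step3 : (N * 2 * 2 ^ h.*2 + m * 2 ^ h.*2 <= n)%N.
  apply: leq_trans mD; rewrite /N /De /edge_size.
  rewrite -(addn1 (8 * _)); move: (2 ^ h.*2)%N (h.*2 ^ 2)%N => q s.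
  by rewrite [leqLHS](_ : _ = m * ((8 * s + 1) * q))%N//; ring.
have step4 : 0 <= 2 * ka by lra.
have step5 : (1 + r ^+ h) ^+ m <= 1 + 2 * ka.
  by apply: excess_budget => //; rewrite ltW.
move=> /(_ step1 step2 step3 step4 step5).
have : (2 * ka + 2 * 2 ^+ b * expR (- (N%:R * r / 32))) / g <= g / 4.
  rewrite ler_pdivrMr//; apply: (@le_trans _ _ (2 * ka + 2 * ka)); first by rewrite lerD2l.
  by rewrite le_eqVlt; apply/predU1P; left; rewrite /ka; field.
have -> : 2 * p = 1 + g by rewrite /g; ring.
by move: (_ / g) => Y; clear -g0; lra.
Qed.

(* [D] is the class of input streams on which the algorithm has to be correct.
   [D := setT] is the unrestricted problem; a smaller [D] expresses a promise.
   The bound holds for every class containing the sparse streams. *)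
Theorem theorem3 (R : realType) :
  exists theta : R -> R, is_Theta_inv_ln theta /\
  forall alpha : R, 0 < alpha < 2^-1 ->
  forall p : R, 2^-1 < p <= 1 ->
  exists (K : nat) (C : R), 0 < C /\
  forall f : R -> R, strictly_monotone_nonneg f -> f 0 = 0 ->
  exists eps : R, 0 < eps /\
  exists n0 : nat, forall n : nat, (n0 <= n)%N ->
  forall k : nat, (0 < k)%N -> k%:R <= alpha * n%:R ->
  forall D : set (stream R n), [set s | sparse_stream K s] `<=` D ->
  forall (d : measure_display) (Om : measurableType d) (P : probability Om R)
    (b : nat) (alg : streaming_algorithm R n b Om),
  approximates_top_sum P alg D f k eps p ->
  C * (n%:R `^ (1 + theta alpha)) <= b%:R.
Proof.
exists (fun alpha => 80 / ln alpha); split.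
  by exists 80, 80; split => // alpha _; rewrite lexx.
move=> alpha /andP[a0 a1] p /andP[p2 p1].
have l0 : ln alpha < 0 by rewrite ln_lt0// a0; lra.
have [L80|L80] := ltP (- ln alpha) 80.
  apply: space_lower_bound_le0 => //.
  have : 80 / ln alpha <= -1 by rewrite ler_ndivrMr// mulN1r ltW.
  lra.
by apply: space_lower_bound_small => //; rewrite invrN mulrN opprK.
Qed.
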